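(* The mapping $\mathfrak{b}$ given on generators by $$\mathfrak{b}(\alpha_0)=\alpha_0,\qquad \mathfrak{b}(\alpha_j)=\frac{\alpha_0\alpha_{d+1}\alpha_{d+2}}{\alpha_{d+2-j}}q^{1/2}\ \ (j=1,\dots,d+1),\qquad \mathfrak{b}(\alpha_{d+2})=\frac{\alpha_1}{\alpha_0}q^{-1/2},$$ $$\mathfrak{b}(z_j)=\frac{\alpha_{d+2-j}}{\alpha_0}q^{n_1+n_2+\cdots+n_{d+1-j}-1/2},\qquad \mathfrak{b}(E_{q,z_j})=E_{n_{d+1-j}}E_{n_{d+2-j}}^{-1}\ \ (j=1,\dots,d),$$ with the convention that $E_{n_{d+1}}$ is the identity operator, extends to an isomorphism $\mathfrak{b}:\mathcal{D}_z^\alpha\to\mathcal{D}_n^\alpha$. In particular, the operators $$\mathfrak{L}^n_k=\mathfrak{b}(\mathfrak{L}^z_k),\qquad k=1,2,\dots,d,$$ where $\mathfrak{L}^z_k=\mathcal{L}_k(z_1,\dots,z_k;\alpha_0,\dots,\alpha_{k+1},z_{k+1})$ (with $z_{d+1}=\alpha_{d+2}$), commute with each other, and therefore $\mathcal{A}_n=\mathfrak{b}(\mathcal{A}_z)=\mathbb{C}[\mathfrak{L}^n_1,\dots,\mathfrak{L}^n_d]$, where $\mathcal{A}_z=\mathbb{C}[\mathfrak{L}^z_1,\dots,\mathfrak{L}^z_d]$, is a commutative subalgebra of $\mathcal{D}_n^\alpha$.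
   Context: Fix $q\in(0,1)$ and an integer $d\ge1$. $\alpha_0,\dots,\alpha_{d+2}$ are parameters (indeterminates). $E_{q,z_j}$ is the $q$-shift $z_j\mapsto qz_j$ acting on functions of $z=(z_1,\dots,z_d)$; $\mathcal{D}_z^\alpha$ is the associative $\mathbb{C}$-algebra of $q$-difference operators $\sum_{\nu}l_\nu E_{q,z}^\nu$ (finite sums over $\nu\in\mathbb{Z}^d$) with coefficients $l_\nu$ rational in $z_1,\dots,z_d$ and in the parameters $\alpha_j$. $E_{n_k}$ is the forward shift $E_{n_k}f(n)=f(n+e_k)$ in the variables $n=(n_1,\dots,n_d)$; $\mathcal{D}_n^\alpha$ is the associative $\mathbb{C}$-algebra of difference operators (finite combinations of integer powers of the $E_{n_k}$) with coefficients rational in $q^{n_1},\dots,q^{n_d}$ and in the parameters $\alpha_j$. Put $\triangle_{q,z_j}=E_{q,z_j}-1$, $\nabla_{q,z_j}=1-E_{q,z_j}^{-1}$; multi-index notation is used, $|\nu|=\sum_j\nu_j$. $I_j$ is the involution $z_j\mapsto z_j^{-1}$ (fixing $z_k$, $k\neq j$) on rational functions of $z$. The operator $\mathcal{L}_d=\mathcal{L}_d(z_1,\dots,z_d;\alpha_0,\dots,\alpha_{d+2})$ (defined for each $d\ge1$): for $\nu\in\{0,1\}^d\setminus\{0\}$ with nonzero components at positions $1\le i_1<\cdots<i_s\le d$, put $$A_\nu=(1-\alpha_{i_1}z_{i_1})\Big(1-\frac{\alpha_{i_1}z_{i_1}}{\alpha_0^2}\Big)\frac{\prod_{k=2}^s\Big(1-\frac{\alpha_{i_k}z_{i_k}z_{i_{k-1}}}{\alpha_{i_{k-1}}}\Big)\Big(1-\frac{q\alpha_{i_k}z_{i_k}z_{i_{k-1}}}{\alpha_{i_{k-1}}}\Big)}{\prod_{k=1}^s(1-z_{i_k}^2)(1-qz_{i_k}^2)}\Big(1-\frac{\alpha_{d+1}\alpha_{d+2}z_{i_s}}{\alpha_{i_s}}\Big)\Big(1-\frac{\alpha_{d+1}z_{i_s}}{\alpha_{i_s}\alpha_{d+2}}\Big).$$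 For $\nu\in\mathbb{Z}^d$ write $\nu=\nu^+-\nu^-$ with $\nu_j^+=\max(\nu_j,0)$, $\nu_j^-=-\min(\nu_j,0)$. For $\nu\in\{-1,0,1\}^d\setminus\{0,1\}^d$ put $A_\nu=I^{\nu^-}(A_{\nu^++\nu^-})$, where $I^{\nu^-}$ is the composition of the $I_j$ with $\nu^-_j=1$. Then $$\mathcal{L}_d=\sum_{\nu\in\{-1,0,1\}^d\setminus\{0\}}(-1)^{|\nu^-|}A_\nu\,\triangle_{q,z}^{\nu^+}\nabla_{q,z}^{\nu^-}.$$ In $\mathfrak{L}^z_k$ the last parameter of $\mathcal{L}_k$ (playing the role of $\alpha_{k+2}$) is set equal to $z_{k+1}$. *)

(* Defs.v *)
From HB Require Import structures.
From mathcomp Require Import all_boot all_order all_algebra.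
From mathcomp Require Import boolp reals.
From mathcomp Require Import complex mpoly.

Set Implicit Arguments.
Unset Strict Implicit.
Unset Printing Implicit Defensive.

Import Order.TTheory GRing.Theory Num.Theory.
Local Open Scope ring_scope.
Local Open Scope complex_scope.

Section Fraction.
Variables (P : idomainType) (K : fieldType) (h : {rmorphism P -> K}).
Hypothesis h_inj : injective h.
Local Notation "p %:F" := (@FracField.tofrac P p).

Lemma frac_numden (f : {fraction P}) : f = (\n_(repr f))%:F / (\d_(repr f))%:F.
Proof.
have d0 := denom_ratioP (repr f).
suff H : f * (\d_(repr f))%:F = (\n_(repr f))%:F.
  by rewrite -H mulfK // tofrac_eq0.
rewrite -{1}[f]reprK; move: (repr f) d0 => u d0.
unlock FracField.tofrac; rewrite -[LHS]FracField.pi_mul; apply/eqmodP.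
rewrite /= FracField.equivfE /FracField.mulf !numden_Ratio ?mulr1 ?oner_neq0 //.
by rewrite mulrC.
Qed.

Lemma numden_lift (p r : P) : r != 0 -> let f := p%:F / r%:F in
  h \n_(repr f) / h \d_(repr f) = h p / h r.
Proof.
move=> r0 f; have d0 := denom_ratioP (repr f).
have hn0 s : s != 0 -> h s != 0 by apply: contraNneq => /eqP; rewrite -(rmorph0 h) (inj_eq h_inj).
apply/eqP; rewrite eqr_div ?hn0 // -!rmorphM (inj_eq h_inj).
by rewrite -(tofrac_eq) !rmorphM /= -eqr_div ?tofrac_eq0 // -frac_numden.
Qed.
End Fraction.

Section Scaling.
Variables (F : fieldType) (n : nat).
Local Notation P := {mpoly F[n]}.
Local Notation K := {fraction P}.
Local Notation "p %:F" := (@FracField.tofrac P p).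

(* Substitution of v i for the i-th variable.  It is the field morphism one
   expects as soon as the v i are algebraically independent over F, which is the
   case for every substitution below: x_j -> q^(nu_j) x_j and x_j -> 1/x_j. *)
Definition rsubst (v : 'I_n -> K) (f : K) : K :=
  mmap (fun c => (c%:MP)%:F) v \n_(repr f) /
  mmap (fun c => (c%:MP)%:F) v \d_(repr f).

Definition rscale (u : 'I_n -> F) : K -> K :=
  rsubst (fun i => ((u i)%:MP)%:F * ('X_i)%:F).

Definition scalep (u : 'I_n -> F) : {rmorphism P -> P} :=
  comp_mpoly [tuple u i *: 'X_i | i < n].

Lemma scalepC u c : scalep u c%:MP = c%:MP.
Proof. exact: comp_mpolyC. Qed.

Lemma scalepX u i : scalep u 'X_i = u i *: 'X_i.
Proof. by rewrite /scalep /= comp_mpolyXU -tnth_nth tnth_mktuple. Qed.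

Lemma mmap_scale u p :
  mmap (fun c => (c%:MP)%:F) (fun i => ((u i)%:MP)%:F * ('X_i)%:F) p =
  (scalep u p)%:F.
Proof.
rewrite /scalep /= comp_mpolyEX /mmap rmorph_sum; apply: eq_bigr => m _.
rewrite -mul_mpolyC rmorphM; congr (_ * _).
rewrite /mmap1 comp_mpolyX rmorph_prod; apply: eq_bigr => i _.
by rewrite tnth_mktuple -mul_mpolyC rmorphXn rmorphM.
Qed.

Lemma scalep_comp u w p :
  scalep u (scalep w p) = scalep (fun i => u i * w i) p.
Proof.
elim/mpolyind: p => [|c m p _ _ IH]; first by rewrite !raddf0.
rewrite !raddfD /= IH; congr (_ + _).
rewrite -!mul_mpolyC !rmorphM !scalepC; congr (_ * _).
rewrite mpolyXE_id !rmorph_prod; apply: eq_bigr => i _.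
rewrite !rmorphXn !scalepX -mul_mpolyC rmorphM scalepC.
by rewrite scalepX mul_mpolyC scalerA mulrC.
Qed.

Lemma scalep1 u p : (forall i, u i = 1) -> scalep u p = p.
Proof.
move=> u1; rewrite -[RHS]comp_mpoly_id /scalep /=; congr (_ \mPo _).
by apply: eq_mktuple => i; rewrite u1 scale1r.
Qed.

Lemma scalep_inj u : (forall i, u i != 0) -> injective (scalep u).
Proof.
move=> u0; apply: (can_inj (g := scalep (fun i => (u i)^-1))) => p.
by rewrite scalep_comp scalep1 // => i; rewrite mulVf.
Qed.

Lemma fracP (f : K) : exists p r : P, r != 0 /\ f = p%:F / r%:F.
Proof.
by exists \n_(repr f), \d_(repr f); split;
  [exact: denom_ratioP | exact: frac_numden].
Qed.

Lemma scalep_neq0 u r : (forall i, u i != 0) -> r != 0 -> scalep u r != 0.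
Proof.
move=> u0; apply: contraNneq => e; apply/eqP/(scalep_inj u0).
by rewrite e raddf0.
Qed.

Lemma rscale_frac u (p r : P) : (forall i, u i != 0) -> r != 0 ->
  rscale u (p%:F / r%:F) = (scalep u p)%:F / (scalep u r)%:F.
Proof.
move=> u0 r0; rewrite /rscale /rsubst !mmap_scale.
apply: (@numden_lift _ _ (@FracField.tofrac P \o scalep u)) => //.
by move=> a b /eqP; rewrite /= tofrac_eq => /eqP /(scalep_inj u0).
Qed.

Lemma rscaleC u c : (forall i, u i != 0) -> rscale u (c%:MP)%:F = (c%:MP)%:F.
Proof.
move=> u0; have -> : (c%:MP)%:F = (c%:MP)%:F / (1 : P)%:F :> K.
  by rewrite rmorph1 divr1.
by rewrite rscale_frac ?oner_neq0 // rmorph1 scalepC.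
Qed.

Lemma rscaleD u f g : (forall i, u i != 0) ->
  rscale u (f + g) = rscale u f + rscale u g.
Proof.
move=> u0; have [a [b [b0 ->]]] := fracP f.
have [a' [b' [b'0 ->]]] := fracP g.
rewrite addf_div ?tofrac_eq0 // -!rmorphM -rmorphD !rscale_frac ?mulf_neq0 //.
rewrite addf_div ?tofrac_eq0 ?scalep_neq0 // -!tofracM -tofracD.
by rewrite !(rmorphM (scalep u)) (rmorphD (scalep u)) !(rmorphM (scalep u)).
Qed.

Lemma rscaleM u f g : (forall i, u i != 0) ->
  rscale u (f * g) = rscale u f * rscale u g.
Proof.
move=> u0; have [a [b [b0 ->]]] := fracP f.
have [a' [b' [b'0 ->]]] := fracP g.
rewrite mulf_div -!tofracM !rscale_frac ?mulf_neq0 // mulf_div -!tofracM.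
by rewrite !(rmorphM (scalep u)).
Qed.

Lemma rscale_comp u w f : (forall i, u i != 0) -> (forall i, w i != 0) ->
  rscale u (rscale w f) = rscale (fun i => u i * w i) f.
Proof.
move=> u0 w0; have [a [b [b0 ->]]] := fracP f.
rewrite !rscale_frac ?scalep_neq0 ?scalep_comp // => i.
by rewrite mulf_neq0.
Qed.

Lemma rscale1 u f : (forall i, u i = 1) -> rscale u f = f.
Proof.
move=> u1; have [a [b [b0 ->]]] := fracP f.
by rewrite rscale_frac ?scalep1 // => i; rewrite u1 oner_neq0.
Qed.
End Scaling.

(* The field C(x_1, ..., x_d, alpha_0, ..., alpha_(d+2)), C := R[i].  The
   polynomial variable of index i is alpha_i for i <= d+2, and x_(i-(d+2)) for
   d+2 < i <= 2d+2.  The letter x stands for z when the field carries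
   q-difference operators in z, and for (q^(n_1), ..., q^(n_d)) when it carries
   difference operators in n. *)
Notation nvar d := ((d + d).+3).
Notation ratf R d := {fraction {mpoly R[i][nvar d]}}.

Section RationalFunctions.
Variables (R : realType) (d : nat).
Local Notation C := R[i].
Local Notation P := {mpoly C[nvar d]}.
Local Notation K := (ratf R d).
Local Notation "p %:F" := (@FracField.tofrac P p).

Definition cst (c : C) : K := (c%:MP)%:F.
Definition var (i : 'I_(nvar d)) : K := ('X_i)%:F.

(* Meaningful for k <= d+2, resp. 1 <= j <= d. *)
Definition alpha (k : nat) : K := var (inord k).
Definition xvar (j : nat) : K := var (inord (d.+2 + j)).

(* The two readings of xvar j: z_j, and q^(n_j). *)
Definition zvar := xvar.
Definition qn := xvar.

Lemma cstD : {morph cst : a b / a + b}.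
Proof. by move=> a b; rewrite /cst mpolyCD tofracD. Qed.
Lemma cstM : {morph cst : a b / a * b}.
Proof. by move=> a b; rewrite /cst mpolyCM tofracM. Qed.
Lemma cst1 : cst 1 = 1.
Proof. by rewrite /cst mpolyC1 tofrac1. Qed.

(* The involution I_j. *)
Definition Iinv (j : nat) : K -> K :=
  rsubst (fun i => if i == inord (d.+2 + j) then (var i)^-1 else var i).

Variables (q : R) (q01 : 0 < q < 1).

(* E^nu : x_j -> q^(nu_j) x_j for 1 <= j <= d; only nu_1, ..., nu_d matter.
   For x = q^n it is n -> n + nu; see shift_eval. *)
Definition shift_var (nu : nat -> int) (i : 'I_(nvar d)) : C :=
  if (i <= d.+2)%N then 1 else q%:C ^ nu (i - d.+2)%N.
Definition shift (nu : nat -> int) : K -> K := rscale (shift_var nu).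

Let qC0 : q%:C != 0 :> C.
Proof. by case/andP: q01 => q0 _; rewrite eq_complex /= eqxx andbT gt_eqF. Qed.

Lemma shift_var_neq0 nu i : shift_var nu i != 0.
Proof. by rewrite /shift_var; case: ifP; rewrite ?oner_neq0 ?expfz_neq0. Qed.

Lemma shift_alpha nu k : (k <= d.+2)%N -> shift nu (alpha k) = alpha k.
Proof.
move=> kd; rewrite /shift -[alpha k]divr1 -[X in _ / X]tofrac1 rscale_frac
  ?oner_neq0 //; last exact: shift_var_neq0.
rewrite tofrac1 scalepX rmorph1 tofrac1 /shift_var inordK ?kd ?scale1r //.
by rewrite ltnS (leq_trans kd) // !ltnS leq_addr.
Qed.

Lemma shift_xvar nu j : (0 < j <= d)%N ->
  shift nu (xvar j) = cst (q%:C ^ nu j) * xvar j.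
Proof.
move=> /andP[j0 jd]; rewrite /shift -[xvar j]divr1 -[X in _ / X]tofrac1.
rewrite rscale_frac ?oner_neq0 //; last exact: shift_var_neq0.
rewrite !tofrac1 scalepX rmorph1 tofrac1 !divr1 /shift_var inordK; last first.
  by rewrite !addSn !ltnS leq_add2l.
by rewrite leqNgt -{1}[d.+2]addn0 ltn_add2l j0 /= addKn -mul_mpolyC tofracM.
Qed.

(* At x = q^n the shift E^nu acts by n -> n + nu. *)
Lemma shift_eval nu (n : nat -> int) (a : nat -> C) (p : P) :
  let pt (m : nat -> int) (i : 'I_(nvar d)) :=
    if (i <= d.+2)%N then a i else q%:C ^ m (i - d.+2)%N in
  (scalep (shift_var nu) p).@[pt n] = p.@[pt (fun j => n j + nu j)].
Proof.
move=> pt; rewrite /scalep /= comp_mpoly_meval; apply: meval_eq => i.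
rewrite tnth_mktuple mevalZ mevalXU /pt /shift_var.
by case: ifP => _; rewrite ?mul1r // expfzDr // mulrC.
Qed.

Lemma shift_cst nu c : shift nu (cst c) = cst c.
Proof. exact/rscaleC/shift_var_neq0. Qed.

Lemma shiftD nu : {morph shift nu : f g / f + g}.
Proof. by move=> f g; exact/rscaleD/shift_var_neq0. Qed.

Lemma shiftM nu : {morph shift nu : f g / f * g}.
Proof. by move=> f g; exact/rscaleM/shift_var_neq0. Qed.

Lemma shift_comp nu mu f :
  shift nu (shift mu f) = shift (fun j => nu j + mu j) f.
Proof.
rewrite /shift rscale_comp; [|exact: shift_var_neq0..].
congr (rscale _ _); apply/funext => i; rewrite /shift_var.
by case: ifP => _; rewrite ?mulr1 // expfzDr.
Qed.

Lemma shift_id f : shift (fun=> 0) f = f.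
Proof. by apply: rscale1 => i; rewrite /shift_var expr0z if_same. Qed.

Lemma shift0 nu : shift nu 0 = 0.
Proof. by apply: (addrI (shift nu 0)); rewrite -shiftD !addr0. Qed.

Lemma shift_sum nu I (r : seq I) (F : I -> K) :
  shift nu (\sum_(i <- r) F i) = \sum_(i <- r) shift nu (F i).
Proof. exact: (big_morph _ (shiftD nu) (shift0 nu)). Qed.

(* Operators sum_nu l_nu E^nu (finite sums, nu in Z^d), realised on the field of
   rational functions.  The latter separates them: q is not a root of unity, so
   that distinct E^nu are distinct automorphisms, hence linearly independent
   over K. *)
Definition is_diffop (T : K -> K) : Prop :=
  exists s : seq (K * (nat -> int)),
    forall f, T f = \sum_(t <- s) t.1 * shift t.2 f.

(* The hypothesis on q is what makes the E^nu automorphisms. *)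
Record diffop (h : 0 < q < 1) := Diffop { dop :> K -> K; _ : `[< is_diffop dop >] }.
Local Notation D := (diffop q01).
HB.instance Definition _ := [isSub of D for @dop q01].
HB.instance Definition _ := [Choice of D by <:].

Definition mk_diffop T (h : is_diffop T) : D := Diffop q01 (asboolT h).

Lemma diffopP (T : D) : is_diffop T.
Proof. exact: asboolW (valP T). Qed.

Lemma diffop_ext (S T : D) : (forall f, S f = T f) -> S = T.
Proof. by move=> ST; apply/val_inj/funext. Qed.

Lemma is_diffop0 : is_diffop (fun=> 0).
Proof. by exists [::] => f; rewrite big_nil. Qed.

Lemma is_diffop_mono l nu : is_diffop (fun f => l * shift nu f).
Proof. by exists [:: (l, nu)] => f; rewrite big_seq1. Qed.

Lemma is_diffop1 : is_diffop id.
Proof.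
have [s sE] := is_diffop_mono 1 (fun=> 0).
by exists s => f; rewrite -sE mul1r shift_id.
Qed.

Lemma is_diffopD (S T : D) : is_diffop (fun f => S f + T f).
Proof.
have [s sE] := diffopP S; have [t tE] := diffopP T.
by exists (s ++ t) => f; rewrite big_cat sE tE.
Qed.

Lemma is_diffopM (S T : D) : is_diffop (fun f => S (T f)).
Proof.
have [s sE] := diffopP S; have [t tE] := diffopP T.
exists [seq (u.1 * shift u.2 v.1, fun j => u.2 j + v.2 j) | u <- s, v <- t].
move=> f; rewrite big_allpairs_dep sE; apply: eq_bigr => u _.
rewrite tE shift_sum mulr_sumr; apply: eq_bigr => v _ /=.
by rewrite shiftM shift_comp mulrA.
Qed.

Lemma is_diffop_coef l : is_diffop (fun f => l * f).
Proof.
have [s sE] := is_diffop_mono l (fun=> 0).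
by exists s => f; rewrite -sE shift_id.
Qed.

Lemma is_diffopN (T : D) : is_diffop (fun f => - T f).
Proof.
have [s sE] := is_diffopM (mk_diffop (is_diffop_coef (-1))) T.
by exists s => f; rewrite -sE /= mulN1r.
Qed.

Lemma is_diffopZ (c : C) (T : D) : is_diffop (fun f => cst c * T f).
Proof. exact: is_diffopM (mk_diffop (is_diffop_coef (cst c))) T. Qed.

Definition diffop0 := mk_diffop is_diffop0.
Definition diffop1 := mk_diffop is_diffop1.
Definition diffop_add S T := mk_diffop (is_diffopD S T).
Definition diffop_opp T := mk_diffop (is_diffopN T).
Definition diffop_mul S T := mk_diffop (is_diffopM S T).
Definition diffop_scale c T := mk_diffop (is_diffopZ c T).

Lemma diffopD (T : D) : {morph T : f g / f + g}.
Proof.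
have [s sE] := diffopP T => f g; rewrite !sE -big_split.
by apply: eq_bigr => t _; rewrite /= shiftD mulrDr.
Qed.

Lemma diffopZ (T : D) c f : T (cst c * f) = cst c * T f.
Proof.
have [s sE] := diffopP T; rewrite !sE mulr_sumr.
by apply: eq_bigr => t _; rewrite shiftM shift_cst mulrCA.
Qed.

Lemma diffop_addA : associative diffop_add.
Proof. by move=> S T U; apply: diffop_ext => f; apply: addrA. Qed.
Lemma diffop_addC : commutative diffop_add.
Proof. by move=> S T; apply: diffop_ext => f; apply: addrC. Qed.
Lemma diffop_add0 : left_id diffop0 diffop_add.
Proof. by move=> S; apply: diffop_ext => f; apply: add0r. Qed.
Lemma diffop_addN : left_inverse diffop0 diffop_opp diffop_add.
Proof. by move=> S; apply: diffop_ext => f; apply: addNr. Qed.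
HB.instance Definition _ := GRing.isZmodule.Build D
  diffop_addA diffop_addC diffop_add0 diffop_addN.

Lemma diffop_mulA : associative diffop_mul.
Proof. by move=> S T U; apply: diffop_ext. Qed.
Lemma diffop_mul1l : left_id diffop1 diffop_mul.
Proof. by move=> S; apply: diffop_ext. Qed.
Lemma diffop_mul1r : right_id diffop1 diffop_mul.
Proof. by move=> S; apply: diffop_ext. Qed.
Lemma diffop_mulDl : left_distributive diffop_mul +%R.
Proof. by move=> S T U; apply: diffop_ext. Qed.
Lemma diffop_mulDr : right_distributive diffop_mul +%R.
Proof. by move=> S T U; apply: diffop_ext => f; apply: diffopD. Qed.
Lemma diffop1_neq0 : diffop1 != 0.
Proof.
apply/eqP => /(congr1 (fun T : D => T 1)) /eqP.
by rewrite /= oner_eq0.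
Qed.
HB.instance Definition _ := GRing.Zmodule_isNzRing.Build D
  diffop_mulA diffop_mul1l diffop_mul1r diffop_mulDl diffop_mulDr diffop1_neq0.

Lemma diffop_scaleA a b T :
  diffop_scale a (diffop_scale b T) = diffop_scale (a * b) T.
Proof. by apply: diffop_ext => f; rewrite /= cstM mulrA. Qed.
Lemma diffop_scale1 : left_id 1 diffop_scale.
Proof. by move=> T; apply: diffop_ext => f; rewrite /= cst1 mul1r. Qed.
Lemma diffop_scaleDr : right_distributive diffop_scale +%R.
Proof. by move=> a S T; apply: diffop_ext => f; apply: mulrDr. Qed.
Lemma diffop_scaleDl T : {morph diffop_scale^~ T : a b / a + b}.
Proof. by move=> a b; apply: diffop_ext => f; rewrite /= cstD mulrDl. Qed.
HB.instance Definition _ := GRing.Zmodule_isLmodule.Build C D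
  diffop_scaleA diffop_scale1 diffop_scaleDr diffop_scaleDl.

Lemma diffop_scaleAl (a : C) (S T : D) : a *: (S * T) = (a *: S) * T.
Proof. exact: diffop_ext. Qed.
HB.instance Definition _ := GRing.Lmodule_isLalgebra.Build C D
  diffop_scaleAl.
Lemma diffop_scaleAr (a : C) (S T : D) : a *: (S * T) = S * (a *: T).
Proof. by apply: diffop_ext => f; rewrite /= diffopZ. Qed.
HB.instance Definition _ := GRing.Lalgebra_isAlgebra.Build C D
  diffop_scaleAr.

Definition coef (l : K) : D := mk_diffop (is_diffop_coef l).

Lemma is_diffop_shift nu : is_diffop (shift nu).
Proof.
have [s sE] := is_diffop_mono 1 nu.
by exists s => f; rewrite -sE mul1r.
Qed.

(* E_j and E_j^{-1}.  Both are the identity for j = d+1, since the shifts only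
   see the components 1, ..., d of their multi-index. *)
Definition E (j : nat) : D :=
  mk_diffop (is_diffop_shift (fun i => (i == j)%:Z)).
Definition Einv (j : nat) : D :=
  mk_diffop (is_diffop_shift (fun i => - (i == j)%:Z)).

Lemma E_mulV j : E j * Einv j = 1.
Proof.
apply: diffop_ext => f /=; rewrite shift_comp -[RHS]shift_id.
by congr (shift _ _); apply/funext => i; rewrite addrN.
Qed.

Lemma E_out : E d.+1 = 1.
Proof.
apply: diffop_ext => f /=; rewrite -[RHS]shift_id.
congr (rscale _ _); apply/funext => i; rewrite /shift_var.
case: leqP => // di; case: eqP => // e; have := ltn_ord i.
by rewrite -(subnK (ltnW di)) e addSn addnS addnS ltnn.
Qed.

(* nu in {-1,0,1}^k is encoded by the disjoint supports Np of nu^+ and Nm of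
   nu^-, and nu in {0,1}^k by its support; the index j : 'I_k stands for the
   position j+1. *)

(* A_nu for nu in {0,1}^k \ 0 of support S, with the parameters a 0, ...,
   a (k+2); here i m is i_m for 1 <= m <= s. *)
Definition Acoef (k : nat) (a : nat -> K) (S : {set 'I_k}) : K :=
  let s := #|S| in
  let i m := nth 0%N [seq (val j).+1 | j <- enum S] m.-1 in
  let z := zvar in
  (1 - a (i 1) * z (i 1)) * (1 - a (i 1) * z (i 1) / a 0 ^+ 2)
  * ((\prod_(2 <= m < s.+1)
        ((1 - a (i m) * z (i m) * z (i m.-1) / a (i m.-1))
         * (1 - cst q%:C * a (i m) * z (i m) * z (i m.-1) / a (i m.-1))))
     / \prod_(1 <= m < s.+1)
        ((1 - z (i m) ^+ 2) * (1 - cst q%:C * z (i m) ^+ 2)))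
  * (1 - a k.+1 * a k.+2 * z (i s) / a (i s))
  * (1 - a k.+1 * z (i s) / (a (i s) * a k.+2)).

Definition Iinvs (k : nat) (N : {set 'I_k}) (f : K) : K :=
  foldr Iinv f [seq (val j).+1 | j <- enum N].

(* L_k(z_1, ..., z_k; a 0, ..., a (k+2)) as an operator in d >= k variables. *)
Definition calL (k : nat) (a : nat -> K) : D :=
  \sum_(Np : {set 'I_k})
    \sum_(Nm : {set 'I_k} | [disjoint Np & Nm] && (Np :|: Nm != set0))
      (-1) ^+ #|Nm| * coef (Iinvs Nm (Acoef a (Np :|: Nm)))
      * (\prod_(j in Np) (E (val j).+1 - 1))
      * (\prod_(j in Nm) (1 - Einv (val j).+1)).

Definition Lz (k : nat) : D :=
  calL k (fun i =>
    if (i == k.+2) && (k < d)%N then zvar k.+1 else alpha i).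

End RationalFunctions.

Arguments alpha {R d} k.
Arguments zvar {R d} j.
Arguments qn {R d} j.
Arguments cst {R d} c.
Arguments coef {R d q q01} l.
Arguments E {R d q q01} j.
Arguments Einv {R d q q01} j.
Arguments Lz {R d q q01} k.

(* C[T_1, ..., T_d], the subalgebra generated by T_1, ..., T_d. *)
Definition gen_subalg (C : fieldType) (A : algType C) (d : nat) (T : nat -> A) :
    {pred A} :=
  [pred t | `[< forall S : {pred A}, GRing.subalg_closed S ->
                  (forall k, (0 < k <= d)%N -> T k \in S) -> t \in S >]].

(* D_z is read with x = z, E j = E_{q,z_j}; D_n with x = q^n, E j = E_{n_j}.
   Both are then the algebra of all finite sums sum_nu l_nu E^nu, with l_nu in
   C(x, alpha) and E_k x_j = q^(k == j) x_j E_k. *)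
Notation Dz := diffop.
Notation Dn := diffop.

(* Main.v *)
(** The map b is conjugation by the automorphism sigma of the field of rational
    functions that substitutes Laurent monomials for the alpha_j and z_j.  It is
    an automorphism because a second monomial substitution inverts it, and it
    maps the q-shifts in z to shifts in n since sigma (z_j) involves
    q^(n_1 + ... + n_(d+1-j)).

    For the commutativity, L_k is up to an additive constant
    a + b s (w + 1/w) + c s^2, where w is the last parameter, s = alpha_(k+1)
    and a, b, c are operators in z_1, ..., z_k.  They obey a recursion in k: with
    P(u) = a + (1 + q) b u + q c u^2, one adds to the triple (a, b, c) the sum,
    over (z, E) = (z_(k+1), E_(k+1)) and (1 / z_(k+1), 1 / E_(k+1)), of
      P(s z) / ((1 - z^2) (1 - q z^2)) (1, - z / s, z^2 / s^2) (E - 1).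
    The recursion preserves the quadratic relations [triple_rel] between a, b and
    c.  These imply L_k(w) P(s w) = P(s w) L_k(q w), so that L_k(z_(k+1))
    commutes with the next triple, hence with all later ones. *)

Require Import Defs.
From HB Require Import structures.
From mathcomp Require Import all_boot all_order all_algebra.
From mathcomp Require Import boolp reals complex mpoly ring zify.
Set Implicit Arguments.
Unset Strict Implicit.
Unset Printing Implicit Defensive.
Import Order.TTheory GRing.Theory Num.Theory.
Local Open Scope ring_scope.
Local Open Scope complex_scope.

(** * The coefficients of one recursion step *)

(** Three operators are enough because the last two factors of A_nu multiply to 1 - s (w + 1/w) y +
    s^2 y^2 with y = z_(i_s) / alpha_(i_s): a, b, c collect the terms weighted by 1, -y, y^2.
    Appending a position m to the support brings in (1 - u y) (1 - q u y) = 1 - (1 + q) u y + q u^2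
    y^2 with u = alpha_m z_m, which is the origin of P(u). A support couples all its positions, so
    the coefficients of two L_k cannot be compared directly. The quadratic relations hide z_1, ...,
    z_k: they rewrite a product of two linear forms in a, b, c on nine ordered monomials. Their
    preservation then amounts to identities between rational functions of the single variable z =
    z_(k+1), one for each relation, monomial and power of E from -2 to 2. For b, the obstacle is
    that substitution in a fraction goes through a chosen representative and is known to be a
    morphism only once it is injective on polynomials. Two substitutions cannot be composed before
    that, so injectivity is drawn from an inverse by means of [frac_rel]. *)

Section StepCoefficients.
Variables (K : fieldType) (q be : K).
Local Notation K3 := (K * K * K)%type.

(* Coordinates, on the ordered monomials aa, ba, bb, bc, cc, ca, a, b, c, of the
   product of two linear combinations of a, b, c subject to the relations
   [triple_rel] below. *)
Definition nf (x y : K3) : nat -> K :=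
  let: (x0, x1, x2) := x in let: (y0, y1, y2) := y in
  nth 0 [:: x0 * y0; q * (x0 * y1) + x1 * y0; x1 * y1 + (q - q^-1) * (x0 * y2);
         x1 * y2 + q^-1 * (x2 * y1); x2 * y2; x0 * y2 + x2 * y0;
         (1 - q) * be * (x0 * y1); - ((q - q^-1) * be * (x0 * y2));
         - ((1 - q) / q * be * (x2 * y1))].

Definition li (x : K3) : nat -> K :=
  let: (x0, x1, x2) := x in nth 0 [:: 0; 0; 0; 0; 0; 0; x0; x1; x2].

Definition scal (t : K) (x : K3) : K3 :=
  let: (x0, x1, x2) := x in (t * x0, t * x1, t * x2).

Definition sub3 (x y : K3) : K3 :=
  let: (x0, x1, x2) := x in let: (y0, y1, y2) := y in
  (x0 - y0, x1 - y1, x2 - y2).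

Definition unit3 (i : nat) : K3 := ((i == 0)%:R, (i == 1)%:R, (i == 2)%:R).

Definition phi (z : K) : K := ((1 - z ^+ 2) * (1 - q * z ^+ 2))^-1.
Definition pcoef (z : K) : K3 := (1, (1 + q) * z, q * z ^+ 2).
Definition lcoef (z : K) : K3 := (1, z + z^-1, 1).

(* Coefficients of E and of E^0 in the i-th component of the recursion step;
   the coefficient of E^-1 is [cf1 i z^-1]. *)
Definition cf1 (i : nat) (z : K) : K3 := scal ((- z) ^+ i * phi z) (pcoef z).
Definition cf0 (i : nat) (z : K) : K3 :=
  sub3 (sub3 (unit3 i) (cf1 i z)) (cf1 i z^-1).

(* Coordinates of the coefficients of E^2, E and E^0 in a product of two
   components. *)
Definition conv2 (z : K) i j k := nf (cf1 i z) (cf1 j (q * z)) k.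
Definition conv1 (z : K) i j k :=
  nf (cf1 i z) (cf0 j (q * z)) k + nf (cf0 i z) (cf1 j z) k.
Definition conv0 (z : K) i j k :=
  nf (cf1 i z) (cf1 j (q * z)^-1) k + nf (cf0 i z) (cf0 j z) k
  + nf (cf1 i z^-1) (cf1 j (q^-1 * z)) k.

(** Coordinate form of [triple_rel] at a fixed power of E: f i j holds the coordinates of the
    product of components i and j, and g i the coefficients of component i. *)
Definition coef_rel (f : nat -> nat -> nat -> K) (g : nat -> K3) : Prop :=
  forall k, (k < 9)%N ->
  [/\ f 0 1 k - q * f 1 0 k = (1 - q) * be * li (g 0) k,
      q * (f 0 2 k - f 2 0 k) = (q ^+ 2 - 1) * (f 1 1 k - be * li (g 1) k)
    & f 1 2 k - q * f 2 1 k = (1 - q) * be * li (g 2) k].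

(** These are the denominators of [phi] at z, q z, z / q and their inverses. The list is stable
    under z -> 1/z, so the powers E^-1 and E^-2 follow from E and E^2. *)
Definition step_generic (z : K) : Prop :=
  [/\ q != 0, z != 0,
      [/\ 1 - z ^+ 2 != 0, 1 - q * z ^+ 2 != 0, 1 - q ^+ 2 * z ^+ 2 != 0 &
      1 - q ^+ 3 * z ^+ 2 != 0] &
      [/\ z ^+ 2 - q != 0, z ^+ 2 - q ^+ 2 != 0 & z ^+ 2 - q ^+ 3 != 0]].

Lemma step_genericV z : step_generic z -> step_generic z^-1.
Proof.
move=> [q0 z0 [h0 h1 h2 h3] [v1 v2 v3]].
have V2 : z ^- 2 != 0 by rewrite invr_eq0 expf_neq0.
have H (w : K) : 1 - w * z ^+ 2 != 0 -> z^-1 ^+ 2 - w != 0.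
  have -> : z^-1 ^+ 2 - w = (1 - w * z ^+ 2) * z ^- 2 by field.
  by move=> h; rewrite mulf_neq0.
have U (w : K) : z ^+ 2 - w != 0 -> 1 - w * z^-1 ^+ 2 != 0.
  have -> : 1 - w * z^-1 ^+ 2 = (z ^+ 2 - w) * z ^- 2 by field.
  by move=> h; rewrite mulf_neq0.
have z1 : z ^+ 2 - 1 != 0 by rewrite -opprB oppr_eq0.
split; [exact: q0 | by rewrite invr_eq0 | split | split].
- by rewrite -[_ ^+ 2]mul1r; exact: U.
- exact: U.
- exact: U.
- exact: U.
- exact: H.
- exact: H.
- exact: H.
Qed.

Lemma lcoefV z : lcoef z^-1 = lcoef z.
Proof. by rewrite /lcoef invrK addrC. Qed.

Lemma cf0V i z : cf0 i z^-1 = cf0 i z.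
Proof.
rewrite /cf0 invrK /sub3; case: (unit3 i) (cf1 i z) (cf1 i z^-1).
by move=> [x0 x1] x2 [[u0 u1] u2] [[v0 v1] v2]; congr (_, _, _); exact: addrAC.
Qed.

Section Generic.
Variables (z : K) (gz : step_generic z).

Ltac nz :=
  repeat (apply/andP; split); rewrite ?oppr_eq0;
  first [ assumption |
  match goal with H : is_true (?y != 0) |- is_true (?x != 0) =>
       first [ (have -> : x = y by ring); exact H
             | (have -> : x = - y by ring); rewrite oppr_eq0; exact H ] end].
Ltac go k := case: gz => q0 z0 [h0 h1 h2 h3] [v1 v2 v3];
  (have qz0 : q * z != 0 by rewrite mulf_neq0);
  case: k => [|[|[|[|[|[|[|[|[|k]]]]]]]]] //= _;
   rewrite /phi; field; nz.

(** Coordinates of the intertwining relation L(z) P(z) = P(z) L(q z); the terms in [be] come from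
    the scalar part of [Lop]. *)
Lemma lcoef_pcoef k : (k < 9)%N ->
  nf (lcoef z) (pcoef z) k - be * (z + z^-1) * li (pcoef z) k =
  nf (pcoef z) (lcoef (q * z)) k - be * (q * z + (q * z)^-1) * li (pcoef z) k.
Proof. go k. Qed.

Lemma lcoef_cf0 i k : (i < 3)%N -> (k < 9)%N ->
  nf (cf0 i z) (lcoef z) k = nf (lcoef z) (cf0 i z) k.
Proof.
case: i => [|[|[|i]]] // _; go k.
Qed.

(** A single component has no E^2 term, so the linear side of the relations is zero here. *)
Lemma coef_rel_conv2 : coef_rel (conv2 z) (fun=> (0, 0, 0)).
Proof. move=> k k9; split; rewrite /conv2; move: k9; go k. Qed.

Lemma coef_rel_conv1 : coef_rel (conv1 z) (cf1^~ z).
Proof. move=> k k9; split; rewrite /conv1; move: k9; go k. Qed.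

Lemma coef_rel_conv0 : coef_rel (conv0 z) (cf0^~ z).
Proof. move=> k k9; split; rewrite /conv0; move: k9; go k. Qed.
End Generic.
End StepCoefficients.

(** * Normal forms and one recursion step *)

Section NormalForm.
Variables (K : fieldType) (D : nzRingType) (co : {rmorphism K -> D}).
Variables (q be : K).
Local Notation K3 := (K * K * K)%type.

Definition triple_rel (a b c : D) : Prop :=
  [/\ a * b - co q * (b * a) = co ((1 - q) * be) * a,
      co q * (a * c - c * a) = co (q ^+ 2 - 1) * (b * b - co be * b)
    & b * c - co q * (c * b) = co ((1 - q) * be) * c].

Section Triple.
Variables (a b c : D).

Definition good (f : K) : Prop :=
  [/\ GRing.comm (co f) a, GRing.comm (co f) b & GRing.comm (co f) c].

Definition good3 (x : K3) : Prop := [/\ good x.1.1, good x.1.2 & good x.2].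

Definition lin (x : K3) : D := co x.1.1 * a + co x.1.2 * b + co x.2 * c.

Definition mon (k : nat) : D :=
  nth 0 [:: a * a; b * a; b * b; b * c; c * c; c * a; a; b; c] k.

Definition ev (v : nat -> K) : D := \sum_(k < 9) co (v k) * mon k.

Lemma co_comm f g : GRing.comm (co f) (co g).
Proof. by rewrite /GRing.comm -!rmorphM mulrC. Qed.

Lemma goodD f g : good f -> good g -> good (f + g).
Proof.
by case=> fa fb fc [ga gb gc]; split; apply/commr_sym; rewrite rmorphD;
  apply: commrD; apply/commr_sym.
Qed.

Lemma goodN f : good f -> good (- f).
Proof.
by case=> fa fb fc; split; apply/commr_sym; rewrite rmorphN; apply: commrN;
  apply/commr_sym.
Qed.

Lemma goodM f g : good f -> good g -> good (f * g).
Proof.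
by case=> fa fb fc [ga gb gc]; split; apply/commr_sym; rewrite rmorphM;
  apply: commrM; apply/commr_sym.
Qed.

Lemma good1 : good 1.
Proof. by split; rewrite rmorph1; apply/commr_sym/commr1. Qed.

Lemma good0 : good 0.
Proof. by split; rewrite rmorph0; apply/commr_sym/commr0. Qed.

Lemma goodX f n : good f -> good (f ^+ n).
Proof.
move=> gf; elim: n => [|n IHn]; first exact: good1.
by rewrite exprS; exact: goodM.
Qed.

Lemma comm_coV f (x : D) : GRing.comm (co f) x -> GRing.comm (co f^-1) x.
Proof.
have [->|f0 fx] := eqVneq f 0; first by rewrite invr0.
have fV : co f^-1 * co f = 1 by rewrite -rmorphM mulVf ?rmorph1.
have Vf : co f * co f^-1 = 1 by rewrite -rmorphM mulfV ?rmorph1.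
rewrite /GRing.comm -[x in LHS]mulr1 -Vf [x * (_ * _)]mulrA -fx.
by rewrite -[_ * x * _]mulrA mulrA fV mul1r.
Qed.

Lemma goodV f : good f -> good f^-1.
Proof. by case=> fa fb fc; split; exact: comm_coV. Qed.

Lemma good_lin f x : good f -> good3 x -> GRing.comm (co f) (lin x).
Proof.
case=> fa fb fc _; rewrite /lin.
by do 2?[apply: commrD]; apply: commrM => //; exact: co_comm.
Qed.

Lemma evD v w : ev (fun k => v k + w k) = ev v + ev w.
Proof.
by rewrite /ev -big_split; apply: eq_bigr => k _; rewrite /= rmorphD mulrDl.
Qed.

Lemma evZ t v : ev (fun k => t * v k) = co t * ev v.
Proof.
by rewrite /ev mulr_sumr; apply: eq_bigr => k _; rewrite rmorphM mulrA.
Qed.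

Lemma evN v : ev (fun k => - v k) = - ev v.
Proof.
by rewrite /ev -sumrN; apply: eq_bigr => k _; rewrite rmorphN mulNr.
Qed.

Lemma eq_ev v w : (forall k, (k < 9)%N -> v k = w k) -> ev v = ev w.
Proof. by move=> vw; apply: eq_bigr => k _; rewrite vw. Qed.

Lemma ev_li x : ev (li x) = lin x.
Proof.
case: x => [[x0 x1] x2].
by rewrite /ev !big_ord_recr big_ord0 /= rmorph0 !mul0r !add0r.
Qed.

Lemma lin_scal t x : lin (scal t x) = co t * lin x.
Proof. by case: x => [[x0 x1] x2]; rewrite /lin /= !rmorphM -!mulrA !mulrDr. Qed.

Hypotheses (q0 : q != 0) (rel : triple_rel a b c).

Lemma triple_ab : a * b = co q * (b * a) + co ((1 - q) * be) * a.
Proof. by case: rel => <- _ _; rewrite addrC subrK. Qed.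

Lemma co_mulKV x : co q^-1 * (co q * x) = x.
Proof. by rewrite mulrA -rmorphM mulVf // rmorph1 mul1r. Qed.

Lemma triple_cb :
  c * b = co q^-1 * (b * c) - co ((1 - q) / q * be) * c.
Proof.
case: rel => _ _ h.
have -> : (1 - q) / q * be = q^-1 * ((1 - q) * be) by rewrite mulrA [_ / q]mulrC.
by rewrite rmorphM -mulrA -h -mulrBr subKr co_mulKV.
Qed.

Lemma triple_ac :
  a * c = c * a + co (q - q^-1) * (b * b) - co ((q - q^-1) * be) * b.
Proof.
case: rel => _ h _; rewrite -addrA rmorphM -mulrA -mulrBr.
have -> : q - q^-1 = q^-1 * (q ^+ 2 - 1) by field.
by rewrite rmorphM -mulrA -h co_mulKV addrC subrK.
Qed.

(** The coefficients of y move left past a, b and c, whence [good3 y]. The products ab, cb and ac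
    are the only ones out of order, and each relation reorders one of them. *)
Lemma lin_mul x y : good3 y -> lin x * lin y = ev (nf q be x y).
Proof.
case: x y => [[x0 x1] x2] [[y0 y1] y2] [[ya0 yb0 yc0] [ya1 yb1 yc1] [ya2 yb2 yc2]].
have mv f g (u v : D) : GRing.comm (co g) u ->
    co f * u * (co g * v) = co (f * g) * (u * v).
  by move=> gu; rewrite rmorphM -!mulrA; congr (_ * _); rewrite mulrA -gu !mulrA.
have cr f g u : co f * (co g * u) = co (g * f) * u.
  by rewrite mulrA -rmorphM mulrC.
set r := q - q^-1; set s := 1 - q.
rewrite [RHS](_ : _ =
    co (x0 * y0) * (a * a) + co (q * (x0 * y1) + x1 * y0) * (b * a)
    + co (x1 * y1 + r * (x0 * y2)) * (b * b)
    + co (x1 * y2 + q^-1 * (x2 * y1)) * (b * c) + co (x2 * y2) * (c * c)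
    + co (x0 * y2 + x2 * y0) * (c * a) + co (s * be * (x0 * y1)) * a
    + co (- (r * be * (x0 * y2))) * b + co (- (s / q * be * (x2 * y1))) * c); last first.
  by rewrite /ev !big_ord_recr big_ord0 /= add0r.
have rE : q - q^-1 = r by []; have sE : 1 - q = s by []; clearbody r s.
rewrite !(rmorphD co) !(rmorphN co) !(mulrDl _ _ (_ * _)) !(mulNr (co _)).
rewrite {1 2}/lin /= !mulrDl !mulrDr !mv // triple_ab triple_cb triple_ac rE sE.
rewrite !(mulrDr (co _)) !(mulrN (co _)) !cr.
by rewrite !addrA [LHS](ACl (1*2*7*8*5*9*11*13*4*10*3*6*12)).
Qed.

End Triple.

Section Step.
Variables (E E' : D) (sh sh' : {rmorphism K -> K}) (z : K) (a b c : D).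
Hypotheses (EE' : E * E' = 1) (E'E : E' * E = 1).
Hypotheses (Eco : forall f, E * co f = co (sh f) * E).
Hypotheses (E'co : forall f, E' * co f = co (sh' f) * E').
Hypotheses (shq : sh q = q) (shz : sh z = q * z).
Hypotheses (sh'q : sh' q = q) (sh'z : sh' z = q^-1 * z).
Hypotheses (Ea : GRing.comm E a) (Eb : GRing.comm E b) (Ec : GRing.comm E c).
Hypotheses (gq : good a b c q) (gz : good a b c z) (gbe : good a b c be).
Hypothesis genz : step_generic q z.
Hypothesis rel : triple_rel a b c.

Local Notation ln := (lin a b c).
Local Notation el := (ev a b c).

(** [cf0] absorbs the two -1 of E - 1 and E' - 1; the form with differences is recovered in
    [tri_stepE]. *)
Definition step (i : nat) : D :=
  ln (cf1 q i z) * E + ln (cf0 q i z) + ln (cf1 q i z^-1) * E'.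

Let q0 : q != 0. Proof. by case: genz. Qed.

Lemma commE' x : GRing.comm E x -> GRing.comm E' x.
Proof.
move=> Ex; rewrite /GRing.comm -[x in LHS]mulr1 -EE' [x * _]mulrA -Ex.
by rewrite !mulrA E'E mul1r.
Qed.

Definition sh3 (s : K -> K) (x : K * K * K) := (s x.1.1, s x.1.2, s x.2).

Lemma E_lin x : E * ln x = ln (sh3 sh x) * E.
Proof.
rewrite /lin !mulrDr !mulrDl !mulrA !Eco -!mulrA.
by congr (_ * _ + _ * _ + _ * _).
Qed.

Lemma E'_lin x : E' * ln x = ln (sh3 sh' x) * E'.
Proof.
rewrite /lin !mulrDr !mulrDl !mulrA !E'co -!mulrA.
by congr (_ * _ + _ * _ + _ * _); exact: commE'.
Qed.

Lemma sh3_cf1 (s : {rmorphism K -> K}) i w :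
  s q = q -> sh3 s (cf1 q i w) = cf1 q i (s w).
Proof.
move=> sq; rewrite /sh3 /cf1 /phi /=.
by rewrite !(rmorph1, rmorphM, rmorphXn, rmorphN, fmorphV, rmorphB, rmorphD) sq.
Qed.

Lemma sh3_cf0 (s : {rmorphism K -> K}) i w :
  s q = q -> sh3 s (cf0 q i w) = cf0 q i (s w).
Proof.
move=> sq; rewrite /cf0 -fmorphV -!sh3_cf1 // /sh3 /sub3.
case: (cf1 q i w) (cf1 q i w^-1) => [[x0 x1] x2] [[y0 y1] y2] /=.
by rewrite !rmorphB !rmorph_nat.
Qed.

Lemma good3_cf1 i w : good a b c w -> good3 a b c (cf1 q i w).
Proof.
move=> gw; have g1 := good1 a b c; have gN := goodN gw.
have gp : good a b c (phi q w).
  apply/goodV/goodM; apply/(goodD g1)/goodN; first exact: goodX.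
  by apply: goodM => //; exact: goodX.
by split => /=; do ?[apply: goodM => //]; rewrite -?exprS; do ?[apply: goodX => //];
  exact: goodD.
Qed.

Lemma good3_cf0 i w : good a b c w -> good3 a b c (cf0 q i w).
Proof.
move=> gw; have := good3_cf1 i gw; have := good3_cf1 i (goodV gw).
have gn (t : bool) : good a b c t%:R by case: t; [exact: good1|exact: good0].
rewrite /cf0 /sub3; case: (cf1 q i w) (cf1 q i w^-1) => [[x0 x1] x2] [[y0 y1] y2].
move=> [/= y0g y1g y2g] [/= x0g x1g x2g].
have gB f g : good a b c f -> good a b c g -> good a b c (f - g).
  by move=> gf gg; exact/goodD/goodN.
by split => /=; apply: (gB) => //; apply: (gB) => //; exact: gn.
Qed.

Definition op5 (v : nat -> nat -> K) : D :=
  \sum_(m < 5) el (v m) * nth 0 [:: E * E; E; 1; E'; E' * E'] m.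

Definition conv (i j : nat) : nat -> nat -> K :=
  nth (fun=> 0) [:: conv2 q be z i j; conv1 q be z i j; conv0 q be z i j;
                    conv1 q be z^-1 i j; conv2 q be z^-1 i j].

Lemma op5E v : op5 v = el (v 0) * (E * E) + el (v 1) * E + el (v 2)
  + el (v 3) * E' + el (v 4) * (E' * E').
Proof. by rewrite /op5 !big_ord_recr big_ord0 /= add0r mulr1. Qed.

Lemma step_mul i j : step i * step j = op5 (conv i j).
Proof.
have gV := goodV gz; have gqz := goodM gq gz; have gqzV := goodV gqz.
have gy : good a b c (q^-1 * z) by apply: goodM => //; exact: goodV.
have gyV := goodV gy.
have yE : (q^-1 * z)^-1 = q * z^-1 by rewrite invfM invrK.
(* Passing E' moves the argument of [cf0] to z / q, while [conv1] at 1/z has it at q / z; the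
   invariance of [cf0] under inversion reconciles the two. *)
have yV : cf0 q j (q^-1 * z) = cf0 q j (q * z^-1) by rewrite -yE cf0V.
have E1 w : E * ln (cf1 q j w) = ln (cf1 q j (sh w)) * E.
  by rewrite E_lin sh3_cf1.
have E0 w : E * ln (cf0 q j w) = ln (cf0 q j (sh w)) * E.
  by rewrite E_lin sh3_cf0.
have E'1 w : E' * ln (cf1 q j w) = ln (cf1 q j (sh' w)) * E'.
  by rewrite E'_lin sh3_cf1.
have E'0 w : E' * ln (cf0 q j w) = ln (cf0 q j (sh' w)) * E'.
  by rewrite E'_lin sh3_cf0.
have swap (x y u v w : D) : u * y = w * u -> x * u * (y * v) = x * w * (u * v).
  by move=> h; rewrite -mulrA (mulrA u) h -!mulrA.
have swap1 (x y u w : D) : u * y = w * u -> x * u * y = x * w * u.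
  by move=> h; rewrite -mulrA h mulrA.
have zV i' : cf0 q i' z^-1 = cf0 q i' z by rewrite cf0V.
have mul3 (u1 u0 u2 v1 v0 v2 : D) :
    (u1 * E + u0 + u2 * E') * (v1 * E + v0 + v2 * E') =
    u1 * E * (v1 * E) + u1 * E * v0 + u1 * E * (v2 * E')
    + (u0 * (v1 * E) + u0 * v0 + u0 * (v2 * E'))
    + (u2 * E' * (v1 * E) + u2 * E' * v0 + u2 * E' * (v2 * E')).
  by rewrite !mulrDl !mulrDr.
rewrite /step mul3.
rewrite (swap _ _ _ _ _ (E1 _)) (swap1 _ _ _ _ (E0 _)) (swap _ _ _ _ _ (E1 z^-1)).
rewrite (swap _ _ _ _ _ (E'1 _)) (swap1 _ _ _ _ (E'0 _)) (swap _ _ _ _ _ (E'1 z^-1)).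
rewrite !fmorphV shz sh'z !mulrA -!(mulrA _ E E) -!(mulrA _ E' E').
rewrite -!(mulrA _ E E') -!(mulrA _ E' E) EE' E'E !mulr1.
rewrite !lin_mul //; do ?[exact: good3_cf1 | exact: good3_cf0].
rewrite op5E /conv -[nth _ _ 0]/(conv2 _ _ _ _ _) -[nth _ _ 1]/(conv1 _ _ _ _ _).
rewrite -[nth _ _ 2]/(conv0 _ _ _ _ _) -[nth _ _ 3]/(conv1 _ _ _ _ _).
rewrite -[nth _ _ 4]/(conv2 _ _ _ _ _).
rewrite /conv2 /conv1 /conv0 !evD !mulrDl !zV yV yE !addrA.
by rewrite [LHS](ACl (1*2*4*3*5*7*8*6*9)).
Qed.

Lemma op5D v w : op5 (fun m k => v m k + w m k) = op5 v + op5 w.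
Proof.
by rewrite /op5 -big_split; apply: eq_bigr => m _; rewrite /= evD mulrDl.
Qed.

Lemma op5N v : op5 (fun m k => - v m k) = - op5 v.
Proof. by rewrite /op5 -sumrN; apply: eq_bigr => m _; rewrite evN mulNr. Qed.

Lemma op5Z t v : op5 (fun m k => t * v m k) = co t * op5 v.
Proof.
by rewrite /op5 mulr_sumr; apply: eq_bigr => m _; rewrite evZ mulrA.
Qed.

Lemma eq_op5 v w :
  (forall m k, (m < 5)%N -> (k < 9)%N -> v m k = w m k) -> op5 v = op5 w.
Proof.
move=> vw; apply: eq_bigr => m _; congr (_ * _).
by apply: eq_ev => k k9; exact: vw.
Qed.

Definition step_coef (i : nat) : nat -> K3 :=
  nth (0, 0, 0) [:: (0, 0, 0); cf1 q i z; cf0 q i z; cf1 q i z^-1; (0, 0, 0)].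

Lemma stepE i : step i = op5 (fun m => li (step_coef i m)).
Proof.
by rewrite op5E !ev_li /step_coef /lin /= rmorph0 !mul0r !(addr0, add0r, mul0r).
Qed.

Lemma coef_rel_conv m : (m < 5)%N ->
  coef_rel q be (fun i j => conv i j m) (fun i => step_coef i m).
Proof.
have gV := step_genericV genz.
case: m => [|[|[|[|[|m]]]]] // _.
- exact: coef_rel_conv2.
- exact: coef_rel_conv1.
- exact: coef_rel_conv0.
- exact: (coef_rel_conv1 be gV).
- exact: (coef_rel_conv2 be gV).
Qed.

Lemma step_rel : triple_rel (step 0) (step 1) (step 2).
Proof.
split; rewrite !step_mul !stepE;
  do !(rewrite -op5Z || rewrite -op5N || rewrite -op5D);
  by apply: eq_op5 => m k m5 k9; have [] := coef_rel_conv m5 k9.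
Qed.

(* [Lop w] is the operator of the first levels, with last parameter [w] and up
   to scaling and a central term. *)
Definition Lop (w : K) : D := ln (lcoef w) - co (be * (w + w^-1)).

Lemma LopV w : Lop w^-1 = Lop w.
Proof. by rewrite /Lop lcoefV invrK [w^-1 + w]addrC. Qed.

Lemma good3_lcoef w : good a b c w -> good3 a b c (lcoef w).
Proof. by split => /=; [exact: good1 | exact/goodD/goodV | exact: good1]. Qed.

Lemma good3_pcoef w : good a b c w -> good3 a b c (pcoef q w).
Proof.
have g1 := good1 a b c.
by split => //=; [apply: goodM => //; exact: goodD | apply/goodM/goodX].
Qed.

Lemma Lop_pcoef w : good a b c w -> step_generic q w ->
  Lop w * ln (pcoef q w) = ln (pcoef q w) * Lop (q * w).
Proof.
move=> gw genw; have gqw := goodM gq gw.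
have gc u : good a b c u -> good a b c (be * (u + u^-1)).
  by move=> gu; apply: goodM => //; apply/goodD/goodV.
rewrite /Lop mulrBl mulrBr -(good_lin (gc _ gqw) (good3_pcoef gw)) !lin_mul //;
  [|exact: good3_lcoef|exact: good3_pcoef].
rewrite -!ev_li -!evZ -!evN -!evD; apply: eq_ev => k k9.
exact: lcoef_pcoef.
Qed.

Lemma good_Lop f w : good a b c w -> good a b c f -> GRing.comm (co f) (Lop w).
Proof.
move=> gw gf; apply: commrB; last exact: co_comm.
exact: good_lin (good3_lcoef gw).
Qed.

Lemma sh3_lcoef (s : {rmorphism K -> K}) w : sh3 s (lcoef w) = lcoef (s w).
Proof. by rewrite /sh3 /lcoef /= rmorphD fmorphV rmorph1. Qed.

Hypotheses (shbe : sh be = be) (sh'be : sh' be = be).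

Lemma E_Lop : E * Lop z = Lop (q * z) * E.
Proof.
rewrite /Lop mulrBr mulrBl E_lin sh3_lcoef Eco shz.
by rewrite rmorphM rmorphD fmorphV shbe shz.
Qed.

Lemma E'_Lop : E' * Lop z^-1 = Lop (q * z^-1) * E'.
Proof.
have -> : q * z^-1 = (q^-1 * z)^-1 by rewrite invfM invrK.
rewrite !LopV /Lop mulrBr mulrBl E'_lin sh3_lcoef E'co sh'z.
by rewrite rmorphM rmorphD fmorphV sh'be sh'z.
Qed.

(** L(w) P(w) F = P(w) L(q w) F = P(w) F L(w): passing P moves w to q w, and passing F moves it
    back. *)
Lemma Lop_comm_cf1 i w (F : D) : good a b c w -> step_generic q w ->
  F * Lop w = Lop (q * w) * F -> GRing.comm (Lop w) (ln (cf1 q i w) * F).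
Proof.
move=> gw genw FL.
have gt : good a b c ((- w) ^+ i * phi q w).
  have [/= + _ _] := good3_cf1 i gw; by rewrite mulr1.
rewrite /GRing.comm /cf1 lin_scal !mulrA -(good_Lop gw gt).
by rewrite -(mulrA (co _) (Lop w)) Lop_pcoef // -!mulrA FL.
Qed.

Lemma step_comm_Lop i : (i < 3)%N -> GRing.comm (Lop z) (step i).
Proof.
move=> i3; have gV := goodV gz; have genV := step_genericV genz.
rewrite /step; apply: commrD; first apply: commrD.
- exact/Lop_comm_cf1/E_Lop.
- apply/commr_sym/commrB; last first.
    apply/commr_sym/good_lin; last exact: good3_cf0.
    by apply: goodM => //; apply: goodD.
  rewrite /GRing.comm !lin_mul //; [|exact: good3_cf0|exact: good3_lcoef].
  by apply: eq_ev => k k9; exact: lcoef_cf0.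
(* Since L(z) = L(1/z), the term in E' is the term in E with z replaced by its inverse. *)
- by rewrite -LopV; exact/Lop_comm_cf1/E'_Lop.
Qed.

End Step.

Section Centralizer.
Variables (X E E' : D) (z : K) (a b c : D).
Hypotheses (EE' : E * E' = 1) (E'E : E' * E = 1).
Hypotheses (Xa : GRing.comm X a) (Xb : GRing.comm X b) (Xc : GRing.comm X c).
Hypotheses (XE : GRing.comm X E) (Xq : GRing.comm X (co q))
  (Xz : GRing.comm X (co z)).

(** With the triple (X, X, X), [good3] says that the coefficients of x commute with X, so the
    closure properties of [good] can be reused. *)
Lemma comm_lin x : good3 X X X x -> GRing.comm X (lin a b c x).
Proof.
case=> [[x0 _ _] [x1 _ _] [x2 _ _]].
by rewrite /lin; do 2?[apply: commrD]; apply: commrM => //; exact: commr_sym.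
Qed.

Lemma comm_step i : GRing.comm X (step E E' z a b c i).
Proof.
have gq : good X X X q by split; exact: commr_sym.
have gz : good X X X z by split; exact: commr_sym.
have XE' : GRing.comm X E' by exact/commr_sym/(commE' EE' E'E)/commr_sym.
rewrite /step; do 2?[apply: commrD]; do ?[apply: commrM => //]; apply: comm_lin.
- exact: good3_cf1.
- exact: good3_cf0.
- exact/good3_cf1/goodV.
Qed.
End Centralizer.


End NormalForm.

(** * The recursion and commutativity *)

Section Scaling.
Variables (K : fieldType) (D : nzRingType) (co : {rmorphism K -> D}) (q : K).

Definition scaled (s : K) (t : nat -> D) (i : nat) : D := co (s ^+ i) * t i.

(** The relations are homogeneous for the weights 0, 1, 2 of a, b, c and weight 1 of [be]. *)
Lemma scaled_rel be s t : (forall j, (j < 3)%N -> GRing.comm (co s) (t j)) ->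
  triple_rel co q be (t 0%N) (t 1%N) (t 2%N) ->
  triple_rel co q (s * be) (scaled s t 0) (scaled s t 1) (scaled s t 2).
Proof.
move=> st [r1 r2 r3].
have mv i j : (i < 3)%N ->
    scaled s t i * scaled s t j = co (s ^+ (i + j)) * (t i * t j).
  move=> i3; have sX : GRing.comm (co (s ^+ j)) (t i).
    by rewrite rmorphXn; apply/commr_sym/commrX/commr_sym/st.
  by rewrite /scaled exprD rmorphM -!mulrA; congr (_ * _); rewrite mulrA -sX mulrA.
have mc f m u : co f * (co m * u) = co m * (co f * u).
  by rewrite !mulrA (co_comm co f).
have ml f i : co (f * (s * be)) * scaled s t i = co (s ^+ i.+1) * (co (f * be) * t i).
  by rewrite /scaled !mulrA -!rmorphM; congr (co _ * _); rewrite exprS; ring.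
split; rewrite !mv // ?[(1 + 0)%N]addn0 ?[(2 + 0)%N]addn0.
- by rewrite ml mc -mulrBr r1.
- rewrite -mulrBr mc r2 -[s * be]mul1r ml mul1r; rewrite -[(1 + 1)%N]/2%N -[(0 + 2)%N]/2%N.
  by rewrite -mulrBr mc.
- by rewrite ml mc -mulrBr r3.
Qed.

End Scaling.

Section Recursion.
Variables (K : fieldType) (D : nzRingType) (co : {rmorphism K -> D}).
Variables (q be ga : K) (al z : nat -> K) (E E' : nat -> D).
Variables (sh sh' : nat -> {rmorphism K -> K}) (d : nat).

(** The initial triple is scalar. [step] is normalised to s = 1: scaling by alpha_k before it turns
    P(z) into P(s z), and scaling back after it turns (- z)^i into (- z / s)^i. *)
Fixpoint tri (k i : nat) : D :=
  if k is k'.+1 then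
    let t := scaled co (al k) (tri k') in
    scaled co (al k)^-1 (step co q (E k) (E' k) (z k) (t 0%N) (t 1%N) (t 2%N)) i
  else nth 0 [:: 1; co be; co ga] i.

Definition Lrec (k : nat) (s w : K) : D :=
  (tri k 0 - 1) + co (s * (w + w^-1)) * (tri k 1 - co be)
  + co (s ^+ 2) * (tri k 2 - co ga).

Definition idx (j : nat) := (0 < j <= d)%N.

Hypotheses (EE' : forall j, E j * E' j = 1) (E'E : forall j, E' j * E j = 1).
Hypotheses (Ecomm : forall i j, GRing.comm (E i) (E j)).
Hypotheses (Eco : forall j f, E j * co f = co (sh j f) * E j).
Hypotheses (E'co : forall j f, E' j * co f = co (sh' j f) * E' j).
Hypotheses (shK : forall j f, sh j f = f -> sh' j f = f).
Hypotheses (shq : forall j, sh j q = q) (shbe : forall j, sh j be = be)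
  (shga : forall j, sh j ga = ga).
Hypotheses (shal : forall j k, idx k -> sh j (al k) = al k).
Hypotheses (shz : forall j, idx j -> sh j (z j) = q * z j).
Hypotheses (sh'z : forall j, idx j -> sh' j (z j) = q^-1 * z j).
Hypotheses (shzN : forall j k, idx k -> j != k -> sh j (z k) = z k).
Hypotheses (genz : forall j, idx j -> step_generic q (z j)).
Hypotheses (al0 : forall j, idx j -> al j != 0).

Lemma idxS k : (k < d)%N -> idx k.+1. Proof. by []. Qed.

Lemma fix_comm j f : sh j f = f -> GRing.comm (co f) (E j).
Proof. by move=> ff; rewrite /GRing.comm Eco ff. Qed.

Lemma comm_scaled X s t i :
  GRing.comm X (co s) -> GRing.comm X (t i) -> GRing.comm X (scaled co s t i).
Proof.
by move=> Xs Xt; rewrite /scaled rmorphXn; apply: commrM => //; exact: commrX.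
Qed.

Lemma comm_triS X k i : (k < d)%N -> GRing.comm X (co q) ->
  (forall j, (j < 3)%N -> GRing.comm X (tri k j)) ->
  GRing.comm X (E k.+1) -> GRing.comm X (co (z k.+1)) ->
  GRing.comm X (co (al k.+1)) -> GRing.comm X (tri k.+1 i).
Proof.
move=> kd Xq Xt XE Xz Xa; have Xs j : (j < 3)%N ->
    GRing.comm X (scaled co (al k.+1) (tri k) j).
  by move=> j3; apply: comm_scaled => //; exact: Xt.
apply: comm_scaled; first exact/commr_sym/comm_coV/commr_sym.
by apply: comm_step => //; exact: Xs.
Qed.

Lemma comm_tri_from X k0 k i : (k0 <= k <= d)%N -> (i < 3)%N ->
  GRing.comm X (co q) -> (forall j, (j < 3)%N -> GRing.comm X (tri k0 j)) ->
  (forall j, (k0 < j <= k)%N -> [/\ GRing.comm X (E j), GRing.comm X (co (z j))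
     & GRing.comm X (co (al j))]) ->
  GRing.comm X (tri k i).
Proof.
move=> + i3 Xq X0; elim: k i i3 => [|k IHk] i i3.
  by rewrite leqn0 andbT => /eqP k00 _; rewrite -k00; exact: X0.
rewrite leq_eqVlt => /andP[/orP[/eqP k0E|k0k] kd] H; first by rewrite -k0E; exact: X0.
have [XE Xz Xa] : [/\ GRing.comm X (E k.+1), GRing.comm X (co (z k.+1))
     & GRing.comm X (co (al k.+1))] by apply: H; rewrite k0k /=.
apply: comm_triS => // j j3; apply: IHk => //; first by rewrite -ltnS k0k ltnW.
by move=> l /andP[k0l lk]; apply: H; rewrite k0l ltnW.
Qed.

Lemma comm_tri0 X i : (i < 3)%N -> GRing.comm X (co be) -> GRing.comm X (co ga) ->
  GRing.comm X (tri 0 i).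
Proof. by case: i => [|[|[|i]]] //= _ _ _; exact: commr1. Qed.

Lemma comm_co_tri f k i : (k <= d)%N -> (i < 3)%N ->
  (forall j, (0 < j <= k)%N -> sh j f = f) -> GRing.comm (co f) (tri k i).
Proof.
move=> kd i3 ff; apply: (@comm_tri_from _ 0) => //; first exact: co_comm.
  by move=> j j3; apply: comm_tri0 => //; exact: co_comm.
by move=> j jk; split; [exact/fix_comm/ff | exact: co_comm | exact: co_comm].
Qed.

Lemma comm_E_tri l k i : (k < l)%N -> (k <= d)%N -> (i < 3)%N ->
  GRing.comm (E l) (tri k i).
Proof.
move=> kl kd i3; apply: (@comm_tri_from _ 0) => //.
- exact/commr_sym/fix_comm.
- by move=> j j3; apply: comm_tri0 => //; exact/commr_sym/fix_comm.
move=> j /andP[j0 jk]; have dj : idx j by rewrite /idx j0 (leq_trans jk).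
split=> //; apply/commr_sym/fix_comm; [apply: shzN => //|exact: shal].
by rewrite gtn_eqF // (leq_ltn_trans jk).
Qed.

Definition tri_step k (i : nat) : D :=
  step co q (E k) (E' k) (z k) (scaled co (al k) (tri k.-1) 0)
    (scaled co (al k) (tri k.-1) 1) (scaled co (al k) (tri k.-1) 2) i.

Lemma triS k i : tri k.+1 i = scaled co (al k.+1)^-1 (tri_step k.+1) i.
Proof. by []. Qed.

Lemma sh_fix_scaled k f i : (k < d)%N -> (i < 3)%N ->
  (forall j, (0 < j <= k)%N -> sh j f = f) ->
  GRing.comm (co f) (scaled co (al k.+1) (tri k) i).
Proof.
move=> kd i3 ff; apply: comm_scaled; first exact: co_comm.
exact: comm_co_tri (ltnW kd) _ _.
Qed.

Lemma good_scaled k f : (k < d)%N -> (forall j, (0 < j <= k)%N -> sh j f = f) ->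
  good co (scaled co (al k.+1) (tri k) 0) (scaled co (al k.+1) (tri k) 1)
    (scaled co (al k.+1) (tri k) 2) f.
Proof. by move=> kd ff; split; apply: sh_fix_scaled. Qed.

Lemma shz_lt k j : (k < d)%N -> (0 < j <= k)%N -> sh j (z k.+1) = z k.+1.
Proof.
move=> kd /andP[_ jk]; apply: shzN; first exact: idxS.
by rewrite ltn_eqF // ltnS.
Qed.

Lemma E_scaled k i : (k < d)%N -> (i < 3)%N ->
  GRing.comm (E k.+1) (scaled co (al k.+1) (tri k) i).
Proof.
move=> kd i3; apply: comm_scaled; last exact: comm_E_tri (ltnW kd) _.
exact/commr_sym/fix_comm/shal.
Qed.

Lemma tri_rel k : (k <= d)%N -> triple_rel co q be (tri k 0) (tri k 1) (tri k 2).
Proof.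
elim: k => [|k IHk] kd.
  rewrite /triple_rel /= !(mulr1, mul1r) !subrr.
  split; do ?(rewrite -rmorphM || rewrite -rmorphB); rewrite ?mulr0 ?rmorph0 //.
    by congr (co _); ring.
  by congr (co _); ring.
have kd' := ltnW kd; have a0 := al0 (idxS kd).
(* Scaling up by alpha_(k+1) and back down leaves [be] unchanged, so all levels share the same
   constant. *)
rewrite !triS; have -> : be = (al k.+1)^-1 * (al k.+1 * be) by rewrite mulKf.
apply: scaled_rel.
  move=> j j3; apply: comm_coV; rewrite /tri_step; apply: comm_step => //.
  all: try exact: co_comm.
  all: try by apply: sh_fix_scaled => // l lk; apply: shal.
  exact/fix_comm/shal.
have gq := good_scaled kd (fun j _ => shq j).
apply: (step_rel (sh := sh k.+1) (sh' := sh' k.+1)) => //.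
- exact/shz.
- exact/shK.
- exact/sh'z.
- exact: E_scaled.
- exact: E_scaled.
- exact: E_scaled.
- by apply: good_scaled => // j jk; exact: shz_lt.
- exact/genz.
apply: scaled_rel; last exact: IHk.
by move=> j j3; apply: comm_co_tri => // l lk; exact: shal.
Qed.

Lemma LrecE k s w : Lrec k s w =
  Lop co (s * be) (scaled co s (tri k) 0) (scaled co s (tri k) 1)
     (scaled co s (tri k) 2) w - 1 - co (s ^+ 2 * ga).
Proof.
rewrite /Lrec /Lop /lin /scaled /= expr0 expr1 !rmorph1 !mul1r !mulrA -rmorphM.
rewrite !mulrBr -!rmorphM [w + _ in RHS]lock.
rewrite [s * be * _]mulrAC [(locked _ : K) * s]mulrC -lock.
by rewrite !addrA [LHS](ACl (1*3*5*4*2*6)).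
Qed.

(** Only at level k + 1 does L_k meet the shift of its own last parameter z_(k+1); [step_comm_Lop]
    settles that level. The later levels bring in shifts and variables that L_k does not involve. *)
Lemma Lrec_comm_tri k l i : (k < l <= d)%N -> (i < 3)%N ->
  GRing.comm (Lrec k (al k.+1) (z k.+1)) (tri l i).
Proof.
move=> /andP[kl ld] i3; have kd : (k < d)%N by exact: leq_trans ld.
have fixL f : (forall j, (0 < j <= k)%N -> sh j f = f) ->
    GRing.comm (Lrec k (al k.+1) (z k.+1)) (co f).
  move=> ff; rewrite /Lrec; apply/commr_sym.
  have cf j : (j < 3)%N -> GRing.comm (co f) (tri k j).
    by move=> j3; apply: comm_co_tri => //; exact: ltnW.
  do 2?[apply: commrD]; do ?[apply: commrM]; do ?[apply: commrB];
    by [exact: cf | exact: co_comm | exact: commr1].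
have LE j : (k.+1 < j <= l)%N -> GRing.comm (Lrec k (al k.+1) (z k.+1)) (E j).
  move=> /andP[kj jl]; have Et m : (m < 3)%N -> GRing.comm (E j) (tri k m).
    by move=> m3; apply: comm_E_tri => //; [exact: ltnW|exact: ltnW].
  have Eal := shal j (idxS kd); have Ez : sh j (z k.+1) = z k.+1.
    by apply: shzN; [exact: idxS | rewrite gtn_eqF].
  have Ef f : sh j f = f -> GRing.comm (E j) (co f) by move/fix_comm/commr_sym.
  rewrite /Lrec; apply/commr_sym.
  do 2?[apply: commrD]; do ?[apply: commrM]; do ?[apply: commrB];
    do ?by [exact: Et | exact: commr1].
  - by apply: Ef; rewrite rmorphM rmorphD fmorphV Eal Ez.
  - exact: Ef.
  - by apply: Ef; rewrite rmorphXn Eal.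
  - exact: Ef.
apply: (@comm_tri_from _ k.+1) => //; first by rewrite kl ld.
- by apply: fixL.
- move=> j j3; rewrite triS; apply: comm_scaled.
    by apply: fixL => m mk; rewrite fmorphV shal.
  apply/commr_sym.
  have fixt f : (forall j, (0 < j <= k.+1)%N -> sh j f = f) ->
      GRing.comm (tri_step k.+1 j) (co f).
    move=> ff; apply/commr_sym/comm_step => //; do ?exact: co_comm;
      try by apply: sh_fix_scaled => // m /andP[m0 mk]; apply: ff; rewrite m0 ltnW.
    by apply: fix_comm; apply: ff; rewrite /= leqnn.
  rewrite LrecE; apply: commrB; first (apply: commrB; last exact: commr1).
    apply/commr_sym; apply: (step_comm_Lop (sh := sh k.+1) (sh' := sh' k.+1)) => //.
    + exact/shz.
    + exact/sh'z.
    + exact: E_scaled.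
    + exact: E_scaled.
    + exact: E_scaled.
    + exact: good_scaled.
    + by apply: good_scaled => // m mk; exact: shz_lt.
    + by apply: good_scaled => // m mk; rewrite rmorphM shbe shal.
    + exact/genz.
    + apply: scaled_rel; last exact/tri_rel/ltnW.
      by move=> m m3; apply: comm_co_tri => //; [exact: ltnW | move=> n nk; exact: shal].
    + by rewrite rmorphM shbe shal.
    + by apply: shK; rewrite rmorphM shbe shal.
  by apply: fixt => m mk; rewrite rmorphM rmorphXn shal ?shga.
move=> j /andP[kj jl]; have dj : idx j by rewrite /idx (leq_ltn_trans _ kj) // (leq_trans jl).
split; first by apply: LE; rewrite kj.
- apply: fixL => m /andP[m0 mk]; apply: shzN => //.
  by rewrite ltn_eqF // (leq_ltn_trans mk) // ltnW.
- by apply: fixL => m mk; exact: shal.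
Qed.

Lemma Lrec_comm k l s w : (k < l <= d)%N ->
  (forall j, (0 < j <= l)%N -> sh j s = s) -> (forall j, (0 < j <= l)%N -> sh j w = w) ->
  GRing.comm (Lrec k (al k.+1) (z k.+1)) (Lrec l s w).
Proof.
move=> kld ss ww; have /andP[kl ld] := kld; have kd : (k < d)%N by exact: leq_trans ld.
have fixL f : (forall j, (0 < j <= l)%N -> sh j f = f) ->
    GRing.comm (Lrec k (al k.+1) (z k.+1)) (co f).
  move=> ff; rewrite /Lrec; apply/commr_sym.
  have cf j : (j < 3)%N -> GRing.comm (co f) (tri k j).
    move=> j3; apply: comm_co_tri => //; [exact: ltnW|move=> m /andP[m0 mk]].
    by apply: ff; rewrite m0 (leq_trans mk) // ltnW.
  do 2?[apply: commrD]; do ?[apply: commrM]; do ?[apply: commrB];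
    by [exact: cf | exact: co_comm | exact: commr1].
rewrite {2}/Lrec; do 2?[apply: commrD]; do ?[apply: commrM]; do ?[apply: commrB];
  do ?by [exact: Lrec_comm_tri | exact: commr1].
- by apply: fixL => j jl; rewrite rmorphM rmorphD fmorphV ss ?ww.
- by apply: fixL.
- by apply: fixL => j jl; rewrite rmorphXn ss.
- by apply: fixL.
Qed.
End Recursion.

(** * Expansion over pairs of disjoint sets *)

Section Positions.

Definition pos (k : nat) (A : {set 'I_k}) : seq nat :=
  [seq (val j).+1 | j <- enum A].

Definition wid (k : nat) (A : {set 'I_k}) : {set 'I_k.+1} := lift ord_max @: A.

Lemma mem_wid k (A : {set 'I_k}) j : (lift ord_max j \in wid A) = (j \in A).
Proof. by rewrite mem_imset //; exact: lift_inj. Qed.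

Lemma max_wid k (A : {set 'I_k}) : ord_max \notin wid A.
Proof. by apply/imsetP => -[j _ /eqP]; rewrite (negbTE (neq_lift _ _)). Qed.

Lemma filter_ordS k (A : pred 'I_k.+1) :
  [seq x <- enum 'I_k.+1 | A x] =
  map (lift ord_max) [seq x <- enum 'I_k | A (lift ord_max x)]
  ++ (if A ord_max then [:: ord_max] else [::]).
Proof.
rewrite enum_ordSr filter_rcons filter_map.
have -> : map (widen_ord (leqnSn k)) =1 map (lift ord_max).
  by apply: eq_map => j; apply: val_inj; rewrite /= /bump leqNgt ltn_ord.
have -> : filter (preim (widen_ord (leqnSn k)) A) =1 filter (preim (lift ord_max) A).
  apply: eq_filter => j /=; congr (A _).
  by apply: val_inj; rewrite /= /bump leqNgt ltn_ord.
by case: (A ord_max); rewrite ?cats0 // cats1.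
Qed.

Lemma posE k (A : {set 'I_k}) : pos A = [seq (val j).+1 | j <- enum 'I_k & j \in A].
Proof. by rewrite [enum _ in RHS]enumT; congr map; exact: eq_filter. Qed.

Lemma pos_wid k (A : {set 'I_k}) : pos (wid A) = pos A.
Proof.
rewrite !posE filter_ordS (negbTE (max_wid A)) cats0 -map_comp.
under eq_filter do rewrite mem_wid.
by apply: eq_map => j; rewrite /= /bump leqNgt ltn_ord.
Qed.

(** The new maximum comes last in the increasing enumeration. This is why A_nu can be built by a
    left fold along its support, in step with the recursion on k. *)
Lemma pos_max k (A : {set 'I_k}) : pos (ord_max |: wid A) = rcons (pos A) k.+1.
Proof.
rewrite !posE filter_ordS in_setU1 eqxx /= map_cat -map_comp cats1 /=.
under eq_filter do rewrite in_setU1 mem_wid eq_sym (negbTE (neq_lift _ _)) /=.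
by congr rcons; apply: eq_map => j; rewrite /= /bump leqNgt ltn_ord.
Qed.

Lemma pos_range k (A : {set 'I_k}) m : m \in pos A -> (0 < m <= k)%N.
Proof. by case/mapP => j _ ->; exact: ltn_ord. Qed.

Lemma pos_eq0 k (A : {set 'I_k}) : (pos A == [::]) = (A == set0).
Proof.
by rewrite -size_eq0 size_map -cardE cards_eq0.
Qed.

Lemma big_set_ordS (V : nmodType) k (F : {set 'I_k.+1} -> V) :
  \sum_(A : {set 'I_k.+1}) F A =
  \sum_(A : {set 'I_k}) (F (wid A) + F (ord_max |: wid A)).
Proof.
rewrite (bigID (fun A : {set _} => ord_max \in A)) /= addrC big_split /=.
congr (_ + _).
  rewrite (reindex_onto (@wid k) (fun A => lift ord_max @^-1: A)) /=; last first.
    move=> A mA; apply/setP => j; have [<-|/unlift_some[i -> _]] := eqVneq ord_max j.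
      by rewrite (negbTE (max_wid _)) (negbTE mA).
    by rewrite mem_wid inE.
  apply: eq_bigl => A; rewrite max_wid; apply/eqP/setP => j.
  by rewrite inE mem_wid.
rewrite (reindex_onto (fun A => ord_max |: wid A) (fun A => lift ord_max @^-1: A)) /=;
  last first.
  move=> A mA; apply/setP => j; have [<-|/unlift_some[i -> _]] := eqVneq ord_max j.
    by rewrite in_setU1 eqxx mA.
  by rewrite in_setU1 mem_wid inE eq_sym (negbTE (neq_lift _ _)).
apply: eq_bigl => A; rewrite in_setU1 eqxx; apply/eqP/setP => j.
by rewrite inE in_setU1 mem_wid eq_sym (negbTE (neq_lift _ _)).
Qed.

Lemma widU k (A B : {set 'I_k}) : wid (A :|: B) = wid A :|: wid B.
Proof. exact: imsetU. Qed.

Lemma disjoint_setU1 (T : finType) x (A B : {set T}) :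
  [disjoint x |: A & B] = (x \notin B) && [disjoint A & B].
Proof. by rewrite -!setI_eq0 setIUl setU_eq0 !setI_eq0 disjoints1. Qed.

Lemma disjoint_wid k (A B : {set 'I_k}) : [disjoint wid A & wid B] = [disjoint A & B].
Proof.
rewrite -!setI_eq0 -imsetI ?imset_eq0 // => i j _ _.
exact: lift_inj.
Qed.

Lemma disjoint_maxl k (A B : {set 'I_k}) :
  [disjoint ord_max |: wid A & wid B] = [disjoint A & B].
Proof. by rewrite disjoint_setU1 max_wid disjoint_wid. Qed.

Lemma disjoint_maxr k (A B : {set 'I_k}) :
  [disjoint wid A & ord_max |: wid B] = [disjoint A & B].
Proof.
by rewrite -!setI_eq0 [in LHS]setIC [in RHS]setIC !setI_eq0 disjoint_maxl.
Qed.

Lemma disjoint_max k (A B : {set 'I_k}) :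
  [disjoint ord_max |: wid A & ord_max |: wid B] = false.
Proof. by rewrite disjoint_setU1 setU11. Qed.

(* The sum over pairs of disjoint subsets of 'I_k.+1, split according to the
   position of the last element. *)
Lemma sum_disjointS (V : nmodType) k (F : {set 'I_k.+1} -> {set 'I_k.+1} -> V) :
  \sum_(A : {set 'I_k.+1}) \sum_(B : {set 'I_k.+1} | [disjoint A & B]) F A B =
  \sum_(A : {set 'I_k}) \sum_(B : {set 'I_k} | [disjoint A & B])
    (F (wid A) (wid B) + F (ord_max |: wid A) (wid B) + F (wid A) (ord_max |: wid B)).
Proof.
rewrite big_set_ordS; apply: eq_bigr => A _.
rewrite [X in X + _]big_mkcond [X in _ + X]big_mkcond !big_set_ordS -big_split.
rewrite [RHS]big_mkcond.
apply: eq_bigr => B _; rewrite disjoint_wid disjoint_maxl disjoint_maxr disjoint_max.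
by case: ifP => _ /=; rewrite ?addr0 // addrAC.
Qed.
End Positions.

Section Expansion.
Variables (K : fieldType) (D : nzRingType) (co : {rmorphism K -> D}).
Variables (q be ga : K) (al z : nat -> K) (E E' : nat -> D).
Variables (I : nat -> {rmorphism K -> K}) (d : nat).

(** Scalar counterpart of the coefficient of E - 1 in one recursion step, with the functions g in
    place of the operators a, b, c. *)
Definition chain_step (m : nat) (w : K) (g : nat -> K) (i : nat) : K :=
  (- w / al m) ^+ i * phi q w *
  (g 0%N + (1 + q) * (al m * w) * g 1%N + q * (al m * w) ^+ 2 * g 2%N).

(* For l = [:: i_1; ...; i_s] with s > 0, the common factors of all A_nu with
   support l, multiplied by (- z_(i_s) / alpha_(i_s)) ^+ i; see
   [chain_prod]. *)
Definition chain (l : seq nat) : nat -> K :=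
  foldl (fun g m => chain_step m (z m) g) (nth 0 [:: 1; be; ga]) l.

Definition flip (ms : seq nat) (f : K) : K := foldr I f ms.

Definition dterm k (A B : {set 'I_k}) (f : K) : D :=
  (-1) ^+ size (pos B) * co (flip (pos B) f)
  * (\prod_(m <- pos A) (E m - 1)) * (\prod_(m <- pos B) (1 - E' m)).

Definition expansion (k i : nat) : D :=
  \sum_(A : {set 'I_k}) \sum_(B : {set 'I_k} | [disjoint A & B])
    dterm A B (chain (pos (A :|: B)) i).

Hypotheses (EE' : forall j, E j * E' j = 1) (E'E : forall j, E' j * E j = 1).
Hypotheses (Ecomm : forall i j, GRing.comm (E i) (E j)).
Hypotheses (Iq : forall j, I j q = q) (Ibe : forall j, idx d j -> I j be = be)
  (Iga : forall j, idx d j -> I j ga = ga).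
Hypotheses (Ial : forall j k, idx d j -> idx d k -> I j (al k) = al k).
Hypotheses (Iz : forall j, idx d j -> I j (z j) = (z j)^-1).
Hypotheses (IzN : forall j k, idx d j -> idx d k -> j != k -> I j (z k) = z k).
Hypotheses (al0 : forall j, idx d j -> al j != 0).

Lemma chain_rcons l m : chain (rcons l m) = chain_step m (z m) (chain l).
Proof. by rewrite /chain -cats1 foldl_cat. Qed.

Lemma morph_chain_step (s : {rmorphism K -> K}) m w g i :
  s q = q -> s (al m) = al m ->
  s (chain_step m w g i) = chain_step m (s w) (s \o g) i.
Proof.
move=> sq sa; rewrite /chain_step /phi /=.
by rewrite !(rmorphM, rmorphXn, rmorphN, fmorphV, rmorphB, rmorphD, rmorph1) sq sa.
Qed.

Lemma eq_chain_step m w g h i : (forall j, g j = h j) ->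
  chain_step m w g i = chain_step m w h i.
Proof. by move=> gh; rewrite /chain_step !gh. Qed.

Lemma flip_chain_step ms m w g i : idx d m ->
  (forall n, n \in ms -> idx d n /\ I n w = w) ->
  flip ms (chain_step m w g i) = chain_step m w (fun j => flip ms (g j)) i.
Proof.
move=> dm; elim: ms => //= n ms IHms H; rewrite IHms; last first.
  by move=> n' n'ms; apply: H; rewrite in_cons n'ms orbT.
have [dn nw] : idx d n /\ I n w = w by apply: H; rewrite mem_head.
by rewrite morph_chain_step ?Ial // nw.
Qed.

Lemma chain_fixed n l i : idx d n -> n \notin l -> (forall m, m \in l -> idx d m) ->
  I n (chain l i) = chain l i.
Proof.
move=> dn; elim/last_ind: l i => [|l m IHl] i.
  move=> _ _; rewrite /chain /=.
  by case: i => [|[|[|i]]] /=; rewrite ?rmorph1 ?Ibe ?Iga // nth_nil rmorph0.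
rewrite mem_rcons inE negb_or => /andP[nm nl] dl.
have dm : idx d m by apply: dl; rewrite mem_rcons mem_head.
have dl' m' : m' \in l -> idx d m'.
  by move=> m'l; apply: dl; rewrite mem_rcons inE m'l orbT.
rewrite chain_rcons morph_chain_step ?Ial // IzN //.
by rewrite /chain_step /= !IHl.
Qed.

Lemma E'comm i j : GRing.comm (E' i) (E j).
Proof. exact: (commE' (EE' i) (E'E i)) (Ecomm i j). Qed.

Lemma dterm_pos k (A : {set 'I_k}) (B : {set 'I_k}) f : (k < d)%N ->
  dterm (ord_max |: wid A) (wid B) f = dterm A B f * (E k.+1 - 1).
Proof.
move=> kd; rewrite /dterm pos_max !pos_wid -cats1 big_cat big_seq1 /=.
rewrite -!mulrA; congr (_ * (_ * (_ * _))).
elim/big_rec: _ => [|m X _ IH]; first by rewrite mulr1 mul1r.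
rewrite mulrA -[RHS]mulrA -IH !mulrA; congr (_ * _).
apply/commr_sym/commrB; last exact: commr1.
by apply/commr_sym/commrB; [exact: commr1 | exact/commr_sym/E'comm].
Qed.

(** The additional sign turns 1 - E' into E' - 1, and the right fold [flip] applies the new
    inversion first. A negative position thus enters as a positive one with z and E inverted. *)
Lemma dterm_neg k (A : {set 'I_k}) (B : {set 'I_k}) f :
  dterm (wid A) (ord_max |: wid B) f = dterm A B (I k.+1 f) * (E' k.+1 - 1).
Proof.
rewrite /dterm pos_max !pos_wid -cats1 big_cat big_seq1 /= size_cat addn1 exprS.
by rewrite /flip foldr_cat /= mulN1r !mulNr -[E' _ - 1]opprB mulrN !mulrA.
Qed.

Lemma dterm_wid k (A : {set 'I_k}) (B : {set 'I_k}) f :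
  dterm (wid A) (wid B) f = dterm A B f.
Proof. by rewrite /dterm !pos_wid. Qed.

Lemma dterm_chain_step k (A B : {set 'I_k}) m w g i : idx d m ->
  (forall n, n \in pos B -> idx d n /\ I n w = w) ->
  dterm A B (chain_step m w g i) =
  co ((- w / al m) ^+ i * phi q w) * (dterm A B (g 0%N)
    + co ((1 + q) * (al m * w)) * dterm A B (g 1%N)
    + co (q * (al m * w) ^+ 2) * dterm A B (g 2%N)).
Proof.
move=> dm dB; rewrite /dterm flip_chain_step // /chain_step.
set x := (- w / al m) ^+ i * phi q w; set a1 := (1 + q) * _; set a2 := q * _.
move: (flip _ (g 0)%N) (flip _ (g 1)%N) (flip _ (g 2)%N) => f0 f1 f2.
rewrite rmorphM !rmorphD (rmorphM co a1) (rmorphM co a2) -signr_odd.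
clearbody x a1 a2.
case: (odd _); rewrite ?expr0 ?expr1 ?mul1r ?mulN1r ?mulNr ?mulrN -?opprD ?mulrN.
  by congr (- _); rewrite !mulrDr !mulrDl !mulrA.
by rewrite !mulrDr !mulrDl !mulrA.
Qed.

Local Notation tr := (tri co q be ga al z E E').

Lemma tri_stepE k i : (k < d)%N -> (i < 3)%N ->
  let P w := tr k 0%N + co ((1 + q) * (al k.+1 * w)) * tr k 1%N
     + co (q * (al k.+1 * w) ^+ 2) * tr k 2%N in
  let x w := co ((- w / al k.+1) ^+ i * phi q w) in
  tr k.+1 i = tr k i + x (z k.+1) * P (z k.+1) * (E k.+1 - 1)
    + x (z k.+1)^-1 * P (z k.+1)^-1 * (E' k.+1 - 1).
Proof.
move=> kd i3 P x; have a0 : al k.+1 != 0 by apply: al0; rewrite /idx.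
rewrite triS /scaled /tri_step /step -pred_Sn.
set t0 := scaled _ _ _ 0; set t1 := scaled _ _ _ 1; set t2 := scaled _ _ _ 2.
have cfE w : co ((al k.+1)^-1 ^+ i) * lin co t0 t1 t2 (cf1 q i w) = x w * P w.
  rewrite /cf1 lin_scal mulrA -rmorphM mulrA -exprMn [_^-1 * _]mulrC.
  congr (_ * _); rewrite /lin /pcoef /t0 /t1 /t2 /scaled /P /= !mulrA -!rmorphM.
  by congr (_ + co _ * _ + co _ * _); rewrite ?expr0 ?mulr1 ?rmorph1 ?mul1r //; ring.
have unitE : co ((al k.+1)^-1 ^+ i) * lin co t0 t1 t2 (unit3 K i) = tr k i.
  have -> : lin co t0 t1 t2 (unit3 K i) = scaled co (al k.+1) (tr k) i.
    case: i i3 {x cfE} => [|[|[|i]]] // _;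
    by rewrite /lin /= rmorph1 !rmorph0 !mul0r !(addr0, add0r) mul1r.
  by rewrite /scaled mulrA -rmorphM -exprMn mulVf // expr1n rmorph1 mul1r.
have subE u v : lin co t0 t1 t2 (sub3 u v) = lin co t0 t1 t2 u - lin co t0 t1 t2 v.
  case: u v => [[u0 u1] u2] [[v0 v1] v2].
  rewrite /lin /= !rmorphB !mulrBl !opprD !addrA.
  by rewrite [LHS](ACl (1*3*5*2*4*6)).
have distr (c u v w e e' : D) : c * (u * e + (w - u - v) + v * e') =
    c * w + c * u * (e - 1) + c * v * (e' - 1).
  rewrite !mulrDr !mulrN !mulrA !mulr1 !addrA.
  by rewrite [LHS](ACl (2*1*3*5*4)).
by rewrite /cf0 !subE distr unitE !cfE.
Qed.

(** Position k + 1 is outside the support, in A or in B, and these cases match the three summands of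
    [tri_stepE]. In the last case the inversion replaces z_(k+1) by its inverse in the new factor
    and fixes the chain of the earlier positions. *)
Lemma tri_expansion k i : (k <= d)%N -> (i < 3)%N -> tr k i = expansion k i.
Proof.
elim: k i => [|k IHk] i kd i3.
  rewrite /expansion; have s0 (A : {set 'I_0}) : A = set0.
    by apply/setP => -[].
  rewrite (big_pred1 set0) => [|A]; last by rewrite (s0 A) /= eqxx.
  rewrite (big_pred1 set0) => [|A]; last by rewrite (s0 A) /= eqxx disjoints_subset sub0set.
  have p0 : pos (set0 : {set 'I_0}) = [::] by apply/eqP; rewrite pos_eq0.
  rewrite /dterm setU0 p0 !big_nil expr0 !mulr1 mul1r /=.
  by case: i i3 => [|[|[|i]]] //= _; rewrite rmorph1.
have kd' : idx d k.+1 by rewrite /idx.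
rewrite tri_stepE // /expansion sum_disjointS !IHk ?(ltnW kd) //.
have lc x a1 a2 X (F : nat -> {set 'I_k} -> {set 'I_k} -> D) :
    let S j := \sum_(A : {set 'I_k}) \sum_(B : {set 'I_k} | [disjoint A & B]) F j A B in
    co x * (S 0%N + co a1 * S 1%N + co a2 * S 2%N) * X =
    \sum_(A : {set 'I_k}) \sum_(B : {set 'I_k} | [disjoint A & B])
      co x * (F 0%N A B + co a1 * F 1%N A B + co a2 * F 2%N A B) * X.
  rewrite /= !(mulr_sumr, mulr_suml) -!big_split /= mulr_sumr mulr_suml.
  apply: eq_bigr => A _; rewrite !(mulr_sumr, mulr_suml) -!big_split /=.
  by rewrite mulr_sumr mulr_suml.
rewrite /expansion !(lc _ _ _ _ (fun j A B => dterm A B (chain (pos (A :|: B)) j))).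
rewrite -!big_split; apply: eq_bigr => A _; rewrite -!big_split; apply: eq_bigr => B AB /=.
have Uw : wid A :|: (ord_max |: wid B) = ord_max |: wid (A :|: B).
  by rewrite setUCA widU.
rewrite dterm_wid dterm_pos // dterm_neg -setUA -widU Uw pos_wid pos_max chain_rcons.
have dB n : n \in pos B -> idx d n /\ n != k.+1.
  move=> /pos_range /andP[n0 nk]; rewrite /idx n0 (leq_trans nk (ltnW kd)).
  by split=> //; rewrite ltn_eqF.
have dAB n : n \in pos (A :|: B) -> idx d n /\ n != k.+1.
  move=> /pos_range /andP[n0 nk]; rewrite /idx n0 (leq_trans nk (ltnW kd)).
  by split=> //; rewrite ltn_eqF.
rewrite dterm_chain_step //; last first.
  by move=> n /dB[dn nk]; split=> //; exact: IzN.
rewrite morph_chain_step ?Ial // Iz // (@eq_chain_step _ _ _ (chain (pos (A :|: B)))).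
  rewrite dterm_chain_step // => n /dB[dn nk]; split=> //.
  by rewrite fmorphV IzN.
by move=> j; apply: chain_fixed => // [|n /dAB[]//]; apply/negP => /dAB[_]; rewrite eqxx.
Qed.

(** After position m the three components are x, - y x, y^2 x with y = z_m / alpha_m. The quadratic
    polynomial of the next step therefore factors as x (1 - u y) (1 - q u y); only at the first
    position does it keep [be] and [ga]. *)
Lemma chain_prod l i : l != [::] ->
  let m j := nth 0%N l j.-1 in let n := size l in
  chain l i = (- z (m n) / al (m n)) ^+ i *
  ((1 + (1 + q) * be * (al (m 1) * z (m 1)) + q * ga * (al (m 1) * z (m 1)) ^+ 2)
  * ((\prod_(2 <= j < n.+1)
        ((1 - al (m j) * z (m j) * z (m j.-1) / al (m j.-1))
         * (1 - q * al (m j) * z (m j) * z (m j.-1) / al (m j.-1))))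
     / \prod_(1 <= j < n.+1)
        ((1 - z (m j) ^+ 2) * (1 - q * z (m j) ^+ 2)))).
Proof.
elim/last_ind: l i => // l x IHl i _ m n.
have mn : m n = x by rewrite /m /n size_rcons nth_rcons ltnn eqxx.
rewrite chain_rcons /chain_step mn -!mulrA; congr (_ * _).
rewrite /n size_rcons [\prod_(1 <= j < _) _]big_nat_recr //= invfM.
have mE : m (size l).+1 = x by rewrite /m nth_rcons ltnn eqxx.
rewrite mE -/(phi q (z x)).
have [l0|l0] := eqVneq l [::].
  have m1 : m 1 = x by move: mE; rewrite l0.
  by rewrite l0 !big_geq //= m1 invr1 /chain /=; ring.
have sl : (0 < size l)%N by rewrite lt0n size_eq0.
pose m' j := nth 0%N l j.-1.
have ml j : (0 < j <= size l)%N -> m j = m' j.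
  by case: j => // j /andP[_ jl]; rewrite /m nth_rcons /= jl.
rewrite [\prod_(2 <= j < (size l).+2) _]big_nat_recr //= mE (ml (size l)) ?sl //=.
rewrite (ml 1%N) // (@eq_big_nat _ _ _ 2 _ _ (fun j =>
   (1 - al (m' j) * z (m' j) * z (m' j.-1) / al (m' j.-1)) *
   (1 - q * al (m' j) * z (m' j) * z (m' j.-1) / al (m' j.-1)))); last first.
  move=> [|[|j]] // /andP[_ jl].
  by rewrite (ml j.+2) // -pred_Sn (ml j.+1) //= ltnW.
rewrite [\prod_(1 <= j < _) _](@eq_big_nat _ _ _ 1 _ _ (fun j =>
  (1 - z (m' j) ^+ 2) * (1 - q * z (m' j) ^+ 2))); last first.
  by move=> j jl; rewrite ml.
rewrite !IHl // -/m' -/(m' (size l)) -/(m' 1%N).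
by rewrite expr0 expr1 mul1r -!/(m' _); ring.
Qed.

Lemma flipD ms f g : flip ms (f + g) = flip ms f + flip ms g.
Proof. by elim: ms => //= m ms ->; rewrite rmorphD. Qed.

Lemma flipMl ms c f : (forall m, m \in ms -> I m c = c) ->
  flip ms (c * f) = c * flip ms f.
Proof.
elim: ms => //= m ms IHms H; rewrite IHms; last first.
  by move=> n nms; apply: H; rewrite inE nms orbT.
by rewrite rmorphM H // mem_head.
Qed.

Lemma dtermD k (A B : {set 'I_k}) f g :
  dterm A B (f + g) = dterm A B f + dterm A B g.
Proof. by rewrite /dterm flipD rmorphD mulrDr !mulrDl. Qed.

Lemma dtermMl k (A B : {set 'I_k}) c f : (forall m, m \in pos B -> I m c = c) ->
  dterm A B (c * f) = co c * dterm A B f.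
Proof.
move=> Ic; rewrite /dterm flipMl // rmorphM !mulrA.
by congr (_ * _ * _ * _); exact/commr_sym/commr_sign.
Qed.

Lemma dterm0 k f : dterm (set0 : {set 'I_k}) set0 f = co f.
Proof.
have p0 : pos (set0 : {set 'I_k}) = [::] by apply/eqP; rewrite pos_eq0.
by rewrite /dterm p0 !big_nil expr0 !mulr1 mul1r.
Qed.

Lemma sum_disjoint_neq0 k (F : {set 'I_k} -> {set 'I_k} -> D) :
  \sum_(A : {set 'I_k}) \sum_(B : {set 'I_k} | [disjoint A & B]) F A B =
  F set0 set0 + \sum_(A : {set 'I_k})
    \sum_(B : {set 'I_k} | [disjoint A & B] && (A :|: B != set0)) F A B.
Proof.
rewrite !pair_big_dep (bigD1 (set0, set0)) /=; last by rewrite disjoints_subset sub0set.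
congr (_ + _); apply: eq_bigl => -[A B] /=.
by rewrite xpair_eqE setU_eq0.
Qed.

Lemma Lrec_expansion k s w : (k <= d)%N ->
  (forall m, (0 < m <= k)%N -> I m s = s) -> (forall m, (0 < m <= k)%N -> I m w = w) ->
  \sum_(A : {set 'I_k})
    \sum_(B : {set 'I_k} | [disjoint A & B] && (A :|: B != set0))
      dterm A B (chain (pos (A :|: B)) 0 + s * (w + w^-1) * chain (pos (A :|: B)) 1
        + s ^+ 2 * chain (pos (A :|: B)) 2) =
  Lrec co q be ga al z E E' k s w.
Proof.
(* The constant is the term with both sets empty, which the sum excludes and [Lrec] subtracts. *)
move=> kd Is Iw; apply: (addrI (co (1 + s * (w + w^-1) * be + s ^+ 2 * ga))).
have p0 : pos (set0 : {set 'I_k}) = [::] by apply/eqP; rewrite pos_eq0.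
have := sum_disjoint_neq0 (fun A B : {set 'I_k} => dterm A B (chain (pos (A :|: B)) 0
  + s * (w + w^-1) * chain (pos (A :|: B)) 1 + s ^+ 2 * chain (pos (A :|: B)) 2)).
rewrite dterm0 setU0 p0 {2 3 4}/chain /= => <-.
set p := s * _; set r := s ^+ 2.
have alg (x0 x1 x2 : D) : co (1 + p * be + r * ga) + ((x0 - 1) + co p * (x1 - co be)
    + co r * (x2 - co ga)) = x0 + co p * x1 + co r * x2.
  rewrite !(rmorphD co) rmorph1 !(rmorphM co) !mulrBr !addrA.
  rewrite [LHS](ACl (4*6*8*(1*5)*(2*7)*(3*9))) /=.
  by rewrite !subrr !addr0.
rewrite /Lrec alg !tri_expansion // /expansion !mulr_sumr -!big_split.
apply: eq_bigr => A _; rewrite !mulr_sumr -!big_split; apply: eq_bigr => B _ /=.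
rewrite !dtermD !dtermMl // => m /pos_range mk; last first.
  by rewrite /p rmorphM rmorphD fmorphV Is // Iw.
by rewrite /r rmorphXn Is.
Qed.

End Expansion.

(** * Substitutions in rational functions *)

Section FractionRelation.
Variables (P : idomainType) (K : fieldType) (h : {rmorphism P -> K}).
Local Notation "p %:F" := (@FracField.tofrac P p).

(* h need not be injective: it extends to the local ring of the fractions with
   a denominator outside its kernel, and frac_rel is the graph of this
   extension. *)
Definition frac_rel (f : {fraction P}) (g : K) : Prop :=
  exists r s, [/\ h s != 0, f = r%:F / s%:F & g = h r / h s].

Lemma frac_rel_den_neq0 s : h s != 0 -> s%:F != 0.
Proof. by rewrite tofrac_eq0; apply: contra => /eqP->; rewrite rmorph0. Qed.

Lemma frac_rel_tofrac p : frac_rel p%:F (h p).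
Proof.
by exists p, 1; rewrite !rmorph1 !divr1; split=> //; exact: oner_neq0.
Qed.

Lemma frac_relD f g f' g' :
  frac_rel f g -> frac_rel f' g' -> frac_rel (f + f') (g + g').
Proof.
move=> [r [s [s0 -> ->]]] [r' [s' [s'0 -> ->]]].
exists (r * s' + r' * s), (s * s'); split.
- by rewrite rmorphM mulf_neq0.
- by rewrite addf_div ?frac_rel_den_neq0 // tofracD !tofracM.
- by rewrite addf_div // rmorphD !rmorphM.
Qed.

Lemma frac_relM f g f' g' :
  frac_rel f g -> frac_rel f' g' -> frac_rel (f * f') (g * g').
Proof.
move=> [r [s [s0 -> ->]]] [r' [s' [s'0 -> ->]]].
exists (r * r'), (s * s'); split.
- by rewrite rmorphM mulf_neq0.
- by rewrite mulf_div !tofracM.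
- by rewrite mulf_div !rmorphM.
Qed.

Lemma frac_relV f g : g != 0 -> frac_rel f g -> frac_rel f^-1 g^-1.
Proof.
move=> g0 [r [s [s0 -> gE]]]; move: g0.
rewrite gE mulf_eq0 negb_or => /andP[r0 _].
by exists s, r; split; rewrite ?invf_div.
Qed.

Lemma frac_rel1 : frac_rel 1 1.
Proof. by have := frac_rel_tofrac 1; rewrite tofrac1 rmorph1. Qed.

Lemma frac_relX f g n : frac_rel f g -> frac_rel (f ^+ n) (g ^+ n).
Proof.
move=> fg; elim: n => [|n IHn]; first exact: frac_rel1.
by rewrite !exprS; exact: frac_relM.
Qed.

Lemma frac_rel_eq0 f g : frac_rel f g -> f = 0 -> g = 0.
Proof.
move=> [r [s [s0 -> ->]]] /eqP; rewrite mulf_eq0 invr_eq0 (negbTE (frac_rel_den_neq0 s0)) orbF.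
by rewrite tofrac_eq0 => /eqP->; rewrite rmorph0 mul0r.
Qed.
End FractionRelation.

Section Substitution.
Variables (F : fieldType) (n : nat).
Local Notation P := {mpoly F[n]}.
Local Notation K := {fraction P}.
Local Notation "p %:F" := (@FracField.tofrac P p).
Local Notation frac := (@FracField.tofrac P).

Definition subst (v : 'I_n -> K) : {rmorphism P -> K} :=
  mmap (frac \o @mpolyC n F) v.

Lemma substC v c : subst v c%:MP = (c%:MP)%:F.
Proof. exact: mmapC. Qed.

Lemma substX v i : subst v 'X_i = v i.
Proof. by rewrite /subst /= mmapX mmap1U. Qed.

Lemma subst_rel (h : {rmorphism P -> K}) (v : 'I_n -> K) (g : {rmorphism P -> K}) :
  (forall c, h c%:MP = g c%:MP) -> (forall i, frac_rel h (v i) (g 'X_i)) ->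
  forall p, frac_rel h (subst v p) (g p).
Proof.
move=> hg vg; elim/mpolyind => [|c m p _ _ IH].
  rewrite !rmorph0; exists 0, 1; rewrite !rmorph0 !mul0r rmorph1.
  by split=> //; exact: oner_neq0.
rewrite !rmorphD; apply: frac_relD => {p}// {IH}.
rewrite -mul_mpolyC !rmorphM substC -hg; apply: frac_relM; first exact: frac_rel_tofrac.
rewrite mpolyXE_id !rmorph_prod; apply: (big_ind2 (frac_rel h)) => [||i _].
- exact: frac_rel1.
- by move=> a b a' b'; exact: frac_relM.
- by rewrite !rmorphXn substX; exact: frac_relX.
Qed.

Definition subst_invertible (v w : 'I_n -> K) : Prop :=
  forall i, frac_rel (subst w) (v i) ('X_i)%:F.

(** Applying w to subst v p = 0 yields p = 0. The relation [frac_rel] gives a meaning to this before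
    w is known to extend to fractions. *)
Lemma subst_inj v w : subst_invertible v w -> injective (subst v).
Proof.
move=> vw; apply: raddf_inj => p p0.
have := subst_rel (h := subst w) (v := v) (g := frac) (substC w) vw p.
by move=> /frac_rel_eq0 /(_ p0) /eqP; rewrite tofrac_eq0 => /eqP.
Qed.

Section Injective.
Variables (v : 'I_n -> K).
Hypothesis v_inj : injective (subst v).

Lemma rsubst_frac p r : r != 0 ->
  rsubst v (p%:F / r%:F) = subst v p / subst v r.
Proof. by move=> r0; exact: (numden_lift v_inj p r0). Qed.

Lemma subst_neq0 r : r != 0 -> subst v r != 0.
Proof. by apply: contra => /eqP r0; apply/eqP/v_inj; rewrite r0 rmorph0. Qed.

Lemma rsubst_is_additive : {morph rsubst v : f g / f - g}.
Proof.
move=> f g; have [a [b [b0 ->]]] := fracP f.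
have [a' [b' [b'0 ->]]] := fracP g.
rewrite -mulNr -tofracN addf_div ?tofrac_eq0 // -!tofracM -tofracD.
rewrite !rsubst_frac ?mulf_neq0 // -mulNr addf_div ?subst_neq0 //.
by rewrite rmorphD !rmorphM rmorphN.
Qed.

Lemma rsubstM : {morph rsubst v : f g / f * g}.
Proof.
move=> f g; have [a [b [b0 ->]]] := fracP f.
have [a' [b' [b'0 ->]]] := fracP g.
rewrite mulf_div -!tofracM !rsubst_frac ?mulf_neq0 // mulf_div.
by rewrite !rmorphM.
Qed.

Lemma rsubst_tofrac p : rsubst v p%:F = subst v p.
Proof.
by rewrite -[p%:F]divr1 -[X in _ / X]tofrac1 rsubst_frac ?oner_neq0 // rmorph1 divr1.
Qed.

Lemma rsubst1 : rsubst v 1 = 1.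
Proof. by rewrite -{1}[1]tofrac1 rsubst_tofrac rmorph1. Qed.
End Injective.

Lemma eq_on_vars (f g : {rmorphism K -> K}) :
  (forall c, f (c%:MP)%:F = g (c%:MP)%:F) ->
  (forall i, f ('X_i)%:F = g ('X_i)%:F) -> f =1 g.
Proof.
move=> fgC fgX k; have [a [b [b0 ->]]] := fracP k.
suff H p : f p%:F = g p%:F by rewrite !fmorph_div !H.
elim/mpolyind: p => [|c m p _ _ IH]; first by rewrite tofrac0 !rmorph0.
rewrite tofracD !rmorphD IH; congr (_ + _).
rewrite -mul_mpolyC tofracM !rmorphM fgC; congr (_ * _).
rewrite mpolyXE_id !(rmorph_prod frac) !rmorph_prod; apply: eq_bigr => i _.
by rewrite !rmorphXn fgX.
Qed.
End Substitution.

(** * Shifts and inversions as field morphisms *)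

Section Morphisms.
Variables (R : realType) (d : nat).
Local Notation K := (ratf R d).

Lemma cst_sub : {morph (@cst R d) : a b / a - b}.
Proof. by move=> a b; rewrite /cst mpolyCB tofracB. Qed.

Lemma cst_monoid : (@cst R d 1 = 1) * {morph (@cst R d) : a b / a * b}.
Proof. by split; [exact: cst1 | exact: cstM]. Qed.

HB.instance Definition _ := GRing.isZmodMorphism.Build R[i] K (@cst R d) cst_sub.
HB.instance Definition _ := GRing.isMonoidMorphism.Build R[i] K (@cst R d) cst_monoid.

Definition inverted (j : nat) (i : 'I_(nvar d)) : K :=
  if i == inord (d.+2 + j) then (var R i)^-1 else var R i.

(** The inversion is its own inverse substitution. *)
Lemma inverted_inj j : injective (subst (inverted j)).
Proof.
apply: (@subst_inj _ _ (inverted j) (inverted j)) => i.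
have := frac_rel_tofrac (subst (inverted j)) ('X_i : {mpoly R[i][nvar d]}).
rewrite substX /inverted; case: ifP => // _ /frac_relV.
rewrite invrK; apply; rewrite invr_eq0 tofrac_eq0; apply/eqP => /(congr1 (meval (fun=> 1))).
by rewrite mevalXU rmorph0 => /eqP; rewrite oner_eq0.
Qed.

Lemma Iinv_sub j : {morph (@Iinv R d j) : f g / f - g}.
Proof. exact: rsubst_is_additive (@inverted_inj j). Qed.

Lemma Iinv_monoid j : (@Iinv R d j 1 = 1) * {morph (@Iinv R d j) : f g / f * g}.
Proof.
by split; [exact: rsubst1 (@inverted_inj j) | exact: rsubstM (@inverted_inj j)].
Qed.

HB.instance Definition _ j := GRing.isZmodMorphism.Build K K (@Iinv R d j) (Iinv_sub j).
HB.instance Definition _ j := GRing.isMonoidMorphism.Build K K (@Iinv R d j) (Iinv_monoid j).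

Lemma Iinv_cst j c : @Iinv R d j (cst c) = cst c.
Proof. by rewrite /Iinv (rsubst_tofrac (@inverted_inj j)) substC. Qed.

Lemma Iinv_var j i : Iinv j (var R i) = inverted j i.
Proof. by rewrite /Iinv (rsubst_tofrac (@inverted_inj j)) substX. Qed.

Lemma alpha_lt k : (k <= d.+2)%N -> (k < nvar d)%N.
Proof. by move=> kd; rewrite ltnS (leq_trans kd) // !ltnS leq_addr. Qed.

Lemma xvar_lt j : (j <= d)%N -> (d.+2 + j < nvar d)%N.
Proof. by move=> jd; rewrite !addSn !ltnS leq_add2l. Qed.

Lemma inord_eq m n : (m < nvar d)%N -> (n < nvar d)%N ->
  (inord m == inord n :> 'I_(nvar d)) = (m == n).
Proof. by move=> hm hn; rewrite -(inj_eq val_inj) [LHS]/eq_op /= !inordK. Qed.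

Lemma Iinv_alpha j k : (0 < j <= d)%N -> (k <= d.+2)%N ->
  Iinv j (alpha k) = alpha k :> K.
Proof.
move=> /andP[j0 jd] kd; rewrite Iinv_var /inverted inord_eq; last 2 first.
- exact: alpha_lt.
- exact: xvar_lt.
by rewrite ltn_eqF // (leq_ltn_trans kd) // -[X in (X < _)%N]addn0 ltn_add2l.
Qed.

Lemma Iinv_zvar j : Iinv j (zvar j) = (zvar j)^-1 :> K.
Proof. by rewrite Iinv_var /inverted eqxx. Qed.

Lemma Iinv_zvarN j k : (0 < j <= d)%N -> (0 < k <= d)%N -> j != k ->
  Iinv j (zvar k) = zvar k :> K.
Proof.
move=> /andP[_ jd] /andP[_ kd] jk; rewrite Iinv_var /inverted inord_eq; last 2 first.
- exact: xvar_lt.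
- exact: xvar_lt.
by rewrite eqn_add2l eq_sym (negbTE jk).
Qed.

Lemma var_neq0 i : var R i != 0 :> K.
Proof.
rewrite tofrac_eq0; apply/eqP => /(congr1 (meval (fun=> 1))).
by rewrite mevalXU rmorph0 => /eqP; rewrite oner_eq0.
Qed.

(** Evaluation at 0 and at 1 would give c two different values. *)
Lemma var_sqr_neq i c : var R i ^+ 2 != cst c :> K.
Proof.
rewrite -rmorphXn tofrac_eq; apply/eqP => e.
have H t : t ^+ 2 = c.
  by have := congr1 (meval (fun=> t)) e; rewrite rmorphXn /= mevalXU mevalC.
by have /eqP := H 1; rewrite -(H 0) expr1n expr0n oner_eq0.
Qed.

Lemma alpha_neq0 k : alpha k != 0 :> K. Proof. exact: var_neq0. Qed.
Lemma zvar_neq0 k : zvar k != 0 :> K. Proof. exact: var_neq0. Qed.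

Section Shift.
Variables (q : R) (q01 : 0 < q < 1).
Local Notation D := (diffop d q01).
Local Notation cq := (@cst R d q%:C).

Lemma shift_sub nu : {morph (@shift R d q nu) : f g / f - g}.
Proof.
move=> f g; rewrite (shiftD q01); congr (_ + _).
by apply: (addrI (shift q nu g)); rewrite -(shiftD q01) !subrr (shift0 d q01).
Qed.

(* q01 makes the shift a morphism, hence the copy of [shift] that depends on
   it. *)
Definition shiftm (h : 0 < q < 1) (nu : nat -> int) : K -> K := shift q nu.

Lemma shiftm_monoid nu : (shiftm q01 nu 1 = 1) * {morph (shiftm q01 nu) : f g / f * g}.
Proof.
by split; [rewrite -cst1; exact: shift_cst | exact: shiftM].
Qed.

HB.instance Definition _ nu :=
  GRing.isZmodMorphism.Build K K (shiftm q01 nu) (shift_sub nu).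
HB.instance Definition _ nu :=
  GRing.isMonoidMorphism.Build K K (shiftm q01 nu) (shiftm_monoid nu).

Definition coefm : K -> D := coef.

Lemma coef_sub : {morph coefm : f g / f - g}.
Proof. by move=> f g; apply: diffop_ext => k; exact: mulrBl. Qed.

Lemma coef_monoid : (coefm 1 = 1) * {morph coefm : f g / f * g}.
Proof.
split; first by apply: diffop_ext => k; exact: mul1r.
by move=> f g; apply: diffop_ext => k; exact/esym/mulrA.
Qed.

HB.instance Definition _ := GRing.isZmodMorphism.Build K D coefm coef_sub.
HB.instance Definition _ := GRing.isMonoidMorphism.Build K D coefm coef_monoid.

Lemma q_neq0 : cq != 0.
Proof.
case/andP: q01 => q0 _; rewrite fmorph_eq0.
by rewrite eq_complex /= eqxx andbT gt_eqF.
Qed.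

Lemma q1_neq0 : 1 + cq != 0.
Proof.
case/andP: q01 => q0 _; rewrite -cst1 -rmorphD fmorph_eq0.
by rewrite eq_complex /= addr0 eqxx andbT gt_eqF // addr_gt0.
Qed.

Lemma zvar_generic j : step_generic cq (zvar j).
Proof.
have H n : zvar j ^+ 2 - cq ^+ n != 0.
  rewrite subr_eq0 -(rmorphXn (@cst R d)); exact: var_sqr_neq.
have G n : 1 - cq ^+ n * zvar j ^+ 2 != 0.
  have qn0 : cq ^+ n != 0 by rewrite expf_neq0 // q_neq0.
  rewrite subr_eq0 eq_sym -(inj_eq (mulfI (invr_neq0 qn0))) mulKf // mulr1.
  rewrite -(rmorphXn (@cst R d)) -fmorphV; exact: var_sqr_neq.
split; [exact: q_neq0 | exact: zvar_neq0 | split | split].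
- by have := G 0%N; rewrite expr0 mul1r.
- exact: (G 1%N).
- exact: (G 2%N).
- exact: (G 3%N).
- exact: (H 1%N).
- exact: (H 2%N).
- exact: (H 3%N).
Qed.
End Shift.
End Morphisms.

(** * Commutativity of the operators L_k *)

Section Factorizations.
Variable K : fieldType.

Lemma first_factors (q t u : K) : q != 0 -> 1 + q != 0 -> t != 0 ->
  1 + (1 + q) * (- (1 + t ^- 2) / (1 + q)) * u + q * (q * t ^+ 2)^-1 * u ^+ 2 =
  (1 - u) * (1 - u / t ^+ 2).
Proof. by move=> q0 q1 t0; field; rewrite t0 q0 q1. Qed.

(** Here x stands for the other factors of A_nu, and the powers of - y / a are those of [chain_prod]
    for i = 0, 1, 2. *)
Lemma last_factors (x s w y a : K) : w != 0 ->
  x * (1 - s * w * y / a) * (1 - s * y / (a * w)) =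
  (- y / a) ^+ 0 * x + s * (w + w^-1) * ((- y / a) ^+ 1 * x)
    + s ^+ 2 * ((- y / a) ^+ 2 * x).
Proof.
move=> w0; rewrite invfM; move: (a^-1) => b.
by rewrite expr0 expr1; field.
Qed.
End Factorizations.

Lemma prod_enum (D : nzRingType) (T : finType) (A : {set T}) (F : T -> D) :
  \prod_(j <- enum A) F j = \prod_(j in A) F j.
Proof. by rewrite -[RHS]big_filter [index_enum _]unlock. Qed.

Section Commutation.
Variables (R : realType) (d : nat) (q : R) (q01 : 0 < q < 1).
Local Notation K := (ratf R d).
Local Notation D := (diffop d q01).
Local Notation cq := (@cst R d q%:C).
Local Notation co := (@coefm R d q q01).

(** [beta0] and [gamma0] are chosen so that 1 + (1 + q) beta0 u + q gamma0 u^2 = (1 - u) (1 - u /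
    alpha_0^2), the first two factors of A_nu at u = alpha_(i_1) z_(i_1). *)
Definition beta0 : K := - (1 + alpha 0 ^- 2) / (1 + cq).
Definition gamma0 : K := (cq * alpha 0 ^+ 2)^-1.

Definition Eshift (j : nat) : {rmorphism K -> K} := shiftm q01 (fun i => (i == j)%:Z).
Definition Einvshift (j : nat) : {rmorphism K -> K} :=
  shiftm q01 (fun i => - (i == j)%:Z).

Lemma Einv_mulE j : Einv j * E j = 1 :> D.
Proof.
apply: diffop_ext => f /=; rewrite (shift_comp q01) -[RHS](shift_id q).
by congr (shift _ _); apply/funext => i; rewrite addNr.
Qed.

Lemma E_comm i j : GRing.comm (E i : D) (E j).
Proof.
apply: diffop_ext => f /=; rewrite !(shift_comp q01).
by congr (shift _ _); apply/funext => m; rewrite addrC.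
Qed.

Lemma E_co j f : (E j : D) * co f = co (Eshift j f) * E j.
Proof. by apply: diffop_ext => g /=; exact: (shiftM q01). Qed.

Lemma Einv_co j f : (Einv j : D) * co f = co (Einvshift j f) * Einv j.
Proof. by apply: diffop_ext => g /=; exact: (shiftM q01). Qed.

Lemma Eshift_fixV j f : Eshift j f = f -> Einvshift j f = f.
Proof.
move=> {1}<-; rewrite /= /shiftm (shift_comp q01) -[RHS](shift_id q).
by congr (shift _ _); apply/funext => i; rewrite addNr.
Qed.

Lemma EshiftE j f : Eshift j f = shift q (fun i => (i == j)%:Z) f.
Proof. by []. Qed.

Lemma EinvshiftE j f : Einvshift j f = shift q (fun i => - (i == j)%:Z) f.
Proof. by []. Qed.

Lemma Eshift_cst j c : Eshift j (cst c) = cst c.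
Proof. by rewrite EshiftE (shift_cst d q01). Qed.

Lemma Eshift_alpha j k : (k <= d.+2)%N -> Eshift j (alpha k) = alpha k.
Proof. by move=> kd; rewrite EshiftE (shift_alpha q01). Qed.

Lemma idx_alpha k : idx d k -> (k <= d.+2)%N.
Proof. by case/andP=> _ kd; rewrite (leq_trans kd) // ltnW. Qed.

Lemma Eshift_beta0 j : Eshift j beta0 = beta0.
Proof.
rewrite /beta0 !(rmorphM, rmorphN, rmorphD, fmorphV, rmorphXn) rmorph1.
by rewrite Eshift_cst Eshift_alpha.
Qed.

Lemma Eshift_gamma0 j : Eshift j gamma0 = gamma0.
Proof.
by rewrite /gamma0 !(rmorphM, fmorphV, rmorphXn) Eshift_cst Eshift_alpha.
Qed.

Lemma Eshift_zvar j : idx d j -> Eshift j (zvar j) = cq * zvar j.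
Proof. by move=> jd; rewrite EshiftE (shift_xvar q01 _ jd) eqxx expr1z. Qed.

Lemma Einvshift_zvar j : idx d j -> Einvshift j (zvar j) = cq^-1 * zvar j.
Proof.
by move=> jd; rewrite EinvshiftE (shift_xvar q01 _ jd) eqxx exprN1 fmorphV.
Qed.

Lemma Eshift_zvarN j k : idx d k -> j != k -> Eshift j (zvar k) = zvar k.
Proof.
move=> kd jk; rewrite EshiftE (shift_xvar q01 _ kd) eq_sym (negbTE jk) expr0z.
by rewrite cst1 mul1r.
Qed.

Definition last_par (k : nat) : K := if (k < d)%N then zvar k.+1 else alpha k.+2.

Lemma last_par_neq0 k : last_par k != 0.
Proof. by rewrite /last_par; case: ifP => _; [exact: zvar_neq0|exact: alpha_neq0]. Qed.

Definition params (k i : nat) : K :=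
  if (i == k.+2) && (k < d)%N then zvar k.+1 else alpha i.

Lemma params_last k : params k k.+2 = last_par k.
Proof. by rewrite /params eqxx. Qed.

Lemma params_le k i : (i <= k.+1)%N -> params k i = alpha i.
Proof. by move=> ik; rewrite /params ltn_eqF. Qed.

Local Notation ch := (chain cq beta0 gamma0 alpha zvar).

Lemma AcoefE k (S : {set 'I_k}) : S != set0 ->
  Acoef q (params k) S = ch (pos S) 0 +
    alpha k.+1 * (last_par k + (last_par k)^-1) * ch (pos S) 1
    + alpha k.+1 ^+ 2 * ch (pos S) 2.
Proof.
move=> S0; have l0 : pos S != [::] by rewrite pos_eq0.
rewrite !chain_prod // /Acoef -/(pos S) cardE -(size_map (fun j => (val j).+1)) -/(pos S).
set m := fun j => nth 0%N (pos S) j.-1.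
have sS : (0 < size (pos S))%N by rewrite lt0n size_eq0.
(* Positions are at most k, so putting z_(k+1) for the parameter of index k + 2 leaves every
   alpha_(i_j) unchanged. *)
have am j : (0 < j <= size (pos S))%N -> params k (m j) = alpha (m j).
  case: j => // j /andP[_ js]; apply: params_le; rewrite ltnW // ltnS.
  by have /andP[] := pos_range (mem_nth 0%N js).
rewrite -/(m 1%N) -/(m (size (pos S))) (am 1%N) // (am (size _)) ?sS ?leqnn //.
rewrite params_last !params_le // first_factors; last 3 first.
- exact: q_neq0.
- exact: q1_neq0.
- exact: alpha_neq0.
rewrite -last_factors; last exact: last_par_neq0.
congr (_ * (_ / _) * _ * _); rewrite !big_nat; apply: eq_bigr => j /andP[j2 js].
rewrite -/(m j) -/(m j.-1) !am //; by case: j j2 js => [|[|j]] // _ js; rewrite /= ltnW.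
Qed.

Lemma dterm_concrete k (A B : {set 'I_k}) f :
  dterm co E Einv (@Iinv R d) A B f =
  (-1) ^+ #|B| * coef (Iinvs B f) * (\prod_(j in A) (E (val j).+1 - 1))
    * (\prod_(j in B) (1 - Einv (val j).+1)) :> D.
Proof.
by rewrite /dterm /pos !big_map size_map -cardE !prod_enum.
Qed.

Lemma Lz_Lrec k : (k <= d)%N ->
  Lz k = Lrec co cq beta0 gamma0 alpha zvar E Einv k (alpha k.+1) (last_par k) :> D.
Proof.
move=> kd; have idk m : (0 < m <= k)%N -> idx d m.
  by case/andP=> m0 mk; rewrite /idx m0 (leq_trans mk).
rewrite -(@Lrec_expansion _ _ co cq beta0 gamma0 alpha zvar E Einv (@Iinv R d) d).
- rewrite /Lz /calL; apply: eq_bigr => A _; apply: eq_bigr => B /andP[_ AB].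
  by rewrite -AcoefE // dterm_concrete.
- exact: E_mulV.
- exact: Einv_mulE.
- exact: E_comm.
- by move=> j; exact: Iinv_cst.
- by move=> j jd; rewrite /beta0 !(rmorphM, rmorphN, rmorphD, fmorphV, rmorphXn)
    rmorph1 /= Iinv_cst Iinv_alpha.
- by move=> j jd; rewrite /gamma0 !(rmorphM, fmorphV, rmorphXn) /= Iinv_cst Iinv_alpha.
- by move=> j i jd /idx_alpha; exact: Iinv_alpha.
- by move=> j _; exact: Iinv_zvar.
- exact: Iinv_zvarN.
- by move=> j _; exact: alpha_neq0.
- exact: kd.
- by move=> m /idk md; apply: Iinv_alpha; rewrite // ltnS ltnW.
- move=> m mk; have md := idk m mk; rewrite /last_par; case: ifP => kd'.
    by apply: Iinv_zvarN => //; rewrite ltn_eqF // ltnS; case/andP: mk.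
  by apply: Iinv_alpha; rewrite // !ltnS.
Qed.

(** As k < d, the last parameter of L_k is z_(k+1), as [Lrec_comm] requires. That of L_l is z_(l+1)
    or alpha_(d+2), and both are fixed by the shifts at positions 1, ..., l. *)
Lemma Lz_comm_lt k l : (k < l <= d)%N -> GRing.comm (Lz k : D) (Lz l).
Proof.
move=> kld; have /andP[kl ld] := kld; have kd := leq_trans kl ld.
rewrite !Lz_Lrec //; last exact: ltnW.
rewrite {1}/last_par kd; apply: (Lrec_comm (sh := Eshift) (sh' := Einvshift) (d := d)).
- exact: E_mulV.
- exact: Einv_mulE.
- exact: E_comm.
- exact: E_co.
- exact: Einv_co.
- exact: Eshift_fixV.
- by move=> j; exact: Eshift_cst.
- exact: Eshift_beta0.
- exact: Eshift_gamma0.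
- by move=> j i /idx_alpha; exact: Eshift_alpha.
- exact: Eshift_zvar.
- exact: Einvshift_zvar.
- exact: Eshift_zvarN.
- by move=> j _; exact: zvar_generic.
- by move=> j _; exact: alpha_neq0.
- exact: kld.
- by move=> j _; apply: Eshift_alpha; rewrite ltnS ltnW.
- move=> j /andP[j0 jl]; rewrite /last_par; case: ifP => ld'.
    by apply: Eshift_zvarN => //; rewrite ltn_eqF.
  by apply: Eshift_alpha; rewrite ltnS.
Qed.

Lemma Lz_comm k l : (k <= d)%N -> (l <= d)%N -> GRing.comm (Lz k : D) (Lz l).
Proof.
move=> kd ld; case: (ltngtP k l) => [kl|lk|->]; last exact: commr_refl.
- by apply: Lz_comm_lt; rewrite kl.
- by apply/commr_sym/Lz_comm_lt; rewrite lk.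
Qed.

End Commutation.

(** * The duality on monomials *)

Section DualMonomials.
Variables (K : fieldType) (qh : K) (d : nat).

(* The images under b of alpha_k and z_j, and under its inverse of
   x_m = q^(n_m); [dual_prod] is the image of x_1 ... x_m. *)
Definition dual_alpha (al : nat -> K) (k : nat) : K :=
  if k == 0%N then al 0%N
  else if k == d.+2 then al 1%N / al 0%N * qh^-1
  else al 0%N * al d.+1 * al d.+2 / al (d.+2 - k)%N * qh.

Definition dual_z (al x : nat -> K) (j : nat) : K :=
  al (d.+2 - j)%N / al 0%N * (\prod_(1 <= i < d.+2 - j) x i) * qh^-1.

Definition dual_prod (al z : nat -> K) (m : nat) : K :=
  if m == 0%N then 1
  else z (d.+1 - m)%N * al (d.+1 - m)%N / (al d.+1 * al d.+2).

Definition dual_x (al z : nat -> K) (m : nat) : K :=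
  dual_prod al z m / dual_prod al z m.-1.

Lemma dual_alpha_mid al k : (0 < k <= d.+1)%N ->
  dual_alpha al k = al 0%N * al d.+1 * al d.+2 / al (d.+2 - k)%N * qh.
Proof.
case/andP=> k0 kd; rewrite /dual_alpha [k == 0%N]gtn_eqF //.
by rewrite ltn_eqF.
Qed.

Lemma dual_alpha0 al : dual_alpha al 0 = al 0%N. Proof. by []. Qed.

Lemma dual_alpha_last al : dual_alpha al d.+2 = al 1%N / al 0%N * qh^-1.
Proof. by rewrite /dual_alpha eqxx. Qed.

Lemma dual_zM al c x j : dual_z al (fun i => c i * x i) j =
  (\prod_(1 <= i < d.+2 - j) c i) * dual_z al x j.
Proof.
rewrite /dual_z big_split /=; move: (\prod_(_ <= _ < _) _) => u.
by move: (\prod_(_ <= _ < _) _) (_^-1) (_^-1) => v w t; ring.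
Qed.

Section Nonzero.
Variables (al : nat -> K).
Hypotheses (qh0 : qh != 0) (al0 : forall k, al k != 0).

Lemma dual_alpha_neq0 k : dual_alpha al k != 0.
Proof.
by rewrite /dual_alpha; do ?[case: ifP => _]; rewrite ?mulf_neq0 ?invr_eq0.
Qed.

Lemma dual_prod_neq0 z m : (forall j, z j != 0) -> dual_prod al z m != 0.
Proof.
by move=> z0; rewrite /dual_prod; case: ifP => _; rewrite ?oner_neq0 ?mulf_neq0 ?invr_eq0 ?mulf_neq0.
Qed.

Lemma dual_x_neq0 z m : (forall j, z j != 0) -> dual_x al z m != 0.
Proof. by move=> z0; rewrite mulf_neq0 ?invr_eq0 ?dual_prod_neq0. Qed.

Lemma dual_z_neq0 x j : (forall i, x i != 0) -> dual_z al x j != 0.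
Proof.
move=> x0; rewrite /dual_z !mulf_neq0 ?invr_eq0 //.
by elim/big_ind: _ => [|u v u0 v0|i _]; rewrite ?oner_neq0 ?mulf_neq0.
Qed.

Lemma prod_dual_x z m : (forall j, z j != 0) ->
  \prod_(1 <= i < m.+1) dual_x al z i = dual_prod al z m.
Proof.
move=> z0; elim: m => [|m IHm]; first by rewrite big_geq.
by rewrite big_nat_recr //= IHm /dual_x mulrC divfK // dual_prod_neq0.
Qed.

Ltac nonzero := by do ?[apply/andP; split]; rewrite ?qh0 ?al0.

(** The substitution preserves alpha_0 and the product alpha_(d+1) alpha_(d+2), and k -> d + 2 - k
    is an involution of 1, ..., d + 1. On the parameters b is thus its own inverse. *)
Lemma dual_alphaK k : (k <= d.+2)%N -> dual_alpha (dual_alpha al) k = al k.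
Proof.
have d1 : (d.+2 - d.+1)%N = 1%N by lia.
have d2 : (d.+2 - 1)%N = d.+1 by lia.
rewrite leq_eqVlt => /predU1P[->|].
  rewrite dual_alpha_last dual_alpha_mid // dual_alpha0 d2; field; nonzero.
rewrite ltnS; case: k => // k kd.
rewrite dual_alpha_mid // dual_alpha0 dual_alpha_last (@dual_alpha_mid al d.+1) ?leqnn //.
rewrite dual_alpha_mid; last by lia.
have -> : (d.+2 - (d.+2 - k.+1) = k.+1)%N by lia.
rewrite d1; field; nonzero.
Qed.

(** [dual_prod] results from solving the formula for b(z_j), j = d + 1 - m, for x_1 ... x_m and
    transforming the parameters back. *)
Lemma dual_prodK x m : (forall j, x j != 0) -> (m <= d)%N ->
  dual_prod (dual_alpha al) (dual_z al x) m = \prod_(1 <= i < m.+1) x i.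
Proof.
move=> x0; case: m => [|m] md; first by rewrite big_geq.
have d1 : (d.+2 - d.+1)%N = 1%N by lia.
have dm : (d.+2 - (d.+1 - m.+1) = m.+2)%N by lia.
rewrite /dual_prod /= dual_alpha_last dual_alpha_mid; last by lia.
rewrite dual_alpha_mid ?leqnn // d1 /dual_z dm.
move: (\prod_(_ <= _ < _) _) => y; field; nonzero.
Qed.

Lemma dual_xK x m : (forall j, x j != 0) -> (0 < m <= d)%N ->
  dual_x (dual_alpha al) (dual_z al x) m = x m.
Proof.
move=> x0 /andP[m0 md]; rewrite /dual_x !dual_prodK //; last by lia.
rewrite prednK // big_nat_recr // mulrC mulKf //.
by elim/big_ind: _ => [|u v u0 v0|i _]; rewrite ?oner_neq0 ?mulf_neq0.
Qed.

Lemma dual_zK z j : (forall j, z j != 0) -> (0 < j <= d)%N ->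
  dual_z (dual_alpha al) (dual_x al z) j = z j.
Proof.
move=> z0 /andP[j0 jd].
have dj : (d.+2 - j = (d.+1 - j).+1)%N by lia.
have dj' : (d.+2 - (d.+1 - j).+1 = j)%N by lia.
have dj'' : (d.+1 - (d.+1 - j) = j)%N by lia.
rewrite /dual_z dj prod_dual_x // dual_alpha_mid; last by lia.
rewrite /dual_prod dj' dj'' ifF; last by lia.
rewrite dual_alpha0; field; nonzero.
Qed.
End Nonzero.
End DualMonomials.

Section DualRelation.
Variables (K : fieldType) (d : nat) (Rel : K -> K -> Prop).
Hypothesis Rel1 : Rel 1 1.
Hypothesis RelM : forall f g f' g', Rel f g -> Rel f' g' -> Rel (f * f') (g * g').
Hypothesis RelV : forall f g, g != 0 -> Rel f g -> Rel f^-1 g^-1.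
Variables (al al' x x' : nat -> K).
Hypotheses (al0 : forall k, al' k != 0) (x0 : forall j, x' j != 0).
Hypothesis Ral : forall k, (k <= d.+2)%N -> Rel (al k) (al' k).
Hypothesis Rx : forall j, (0 < j <= d)%N -> Rel (x j) (x' j).

(** An arbitrary relation compatible with products and inverses covers two uses: [frac_rel], before
    the substitution is known to be a morphism, and the graph of a field morphism afterwards. *)
Lemma Rel_dual_prod m : (m <= d)%N ->
  Rel (dual_prod d al x m) (dual_prod d al' x' m).
Proof.
rewrite /dual_prod; case: eqP => // /eqP; rewrite -lt0n => m0 md.
apply: RelM; first apply: RelM.
- by apply: Rx; lia.
- by apply: Ral; lia.
- by apply: RelV; [rewrite mulf_neq0 | apply: RelM; exact: Ral].
Qed.

Lemma Rel_dual_x m : (0 < m <= d)%N ->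
  Rel (dual_x d al x m) (dual_x d al' x' m).
Proof.
case/andP=> m0 md; apply: RelM; first exact: Rel_dual_prod.
apply: RelV; first exact: dual_prod_neq0.
by apply: Rel_dual_prod; rewrite (leq_trans (leq_pred _)).
Qed.
Variable qh : K.
Hypotheses (Relq : Rel qh qh) (qh0 : qh != 0).

Lemma Rel_dual_alpha k : (k <= d.+2)%N ->
  Rel (dual_alpha qh d al k) (dual_alpha qh d al' k).
Proof.
move=> kd; rewrite /dual_alpha; case: ifP => _; first exact: Ral.
case: ifP => _; first by do ?[apply: RelM]; do ?[apply: RelV]; try exact: Ral.
by do ?[apply: RelM]; do ?[apply: RelV]; try apply: Ral; rewrite ?leq_subr.
Qed.

Lemma Rel_dual_z j : (0 < j <= d)%N ->
  Rel (dual_z qh d al x j) (dual_z qh d al' x' j).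
Proof.
case/andP=> j0 jd; rewrite /dual_z; do ?[apply: RelM]; do ?[apply: RelV => //].
- by apply: Ral; rewrite leq_subr.
- exact: Ral.
rewrite !big_nat; apply: (big_ind2 Rel) => // i /andP[i0 id].
by apply: Rx; lia.
Qed.

End DualRelation.

Section DualMorphism.
Variables (K : fieldType) (f : {rmorphism K -> K}) (qh : K) (d : nat).
Variables (al al' x x' : nat -> K).
Hypotheses (al0 : forall k, al' k != 0) (x0 : forall j, x' j != 0).
Hypothesis fal : forall k, (k <= d.+2)%N -> f (al k) = al' k.
Hypothesis fx : forall j, (0 < j <= d)%N -> f (x j) = x' j.

Let Rel (u v : K) := f u = v.
Let Rel1 : Rel 1 1. Proof. exact: rmorph1. Qed.
Let RelM u v u' v' : Rel u v -> Rel u' v' -> Rel (u * u') (v * v').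
Proof. by rewrite /Rel => <- <-; exact: rmorphM. Qed.
Let RelV u v : v != 0 -> Rel u v -> Rel u^-1 v^-1.
Proof. by rewrite /Rel => _ <-; exact: fmorphV. Qed.

Lemma morph_dual_x j : (0 < j <= d)%N -> f (dual_x d al x j) = dual_x d al' x' j.
Proof. exact: (@Rel_dual_x _ d Rel). Qed.

Hypotheses (fq : f qh = qh) (qh0 : qh != 0).

Lemma morph_dual_alpha k : (k <= d.+2)%N ->
  f (dual_alpha qh d al k) = dual_alpha qh d al' k.
Proof. exact: (@Rel_dual_alpha _ d Rel). Qed.

Lemma morph_dual_z j : (0 < j <= d)%N ->
  f (dual_z qh d al x j) = dual_z qh d al' x' j.
Proof. exact: (@Rel_dual_z _ d Rel). Qed.
End DualMorphism.

(** * The duality as a field automorphism *)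

Section Duality.
Variables (R : realType) (d : nat) (q : R) (q01 : 0 < q < 1).
Local Notation K := (ratf R d).
Local Notation D := (diffop d q01).
Local Notation alp := (@alpha R d).
Local Notation zv := (@zvar R d).
Local Notation frac := (@FracField.tofrac {mpoly R[i][nvar d]}).

Definition qhalf : K := cst (Num.sqrt q)%:C.
Local Notation qh := qhalf.

Lemma qhalf_neq0 : qh != 0.
Proof.
case/andP: q01 => q0 _; rewrite fmorph_eq0.
by rewrite eq_complex /= eqxx andbT gt_eqF // sqrtr_gt0.
Qed.

Definition dual_var (i : 'I_(nvar d)) : K :=
  if (i <= d.+2)%N then dual_alpha qh d alp i else dual_z qh d alp zv (i - d.+2).

Definition dual_varV (i : 'I_(nvar d)) : K :=
  if (i <= d.+2)%N then dual_alpha qh d alp i else dual_x d alp zv (i - d.+2).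

Lemma var_cases (i : 'I_(nvar d)) :
  (exists2 k, (k <= d.+2)%N & i = inord k) \/
  (exists2 j, (0 < j <= d)%N & i = inord (d.+2 + j)).
Proof.
have := ltn_ord i; case: (leqP i d.+2) => [id _|di il].
  by left; exists (val i) => //; rewrite inord_val.
right; exists (i - d.+2)%N; first by lia.
by rewrite subnKC ?inord_val // ltnW.
Qed.

Lemma dual_var_alpha k : (k <= d.+2)%N ->
  (dual_var (inord k) = dual_alpha qh d alp k) *
  (dual_varV (inord k) = dual_alpha qh d alp k).
Proof. by move=> kd; rewrite /dual_var /dual_varV inordK ?alpha_lt // kd. Qed.

Lemma dual_var_x j : (0 < j <= d)%N ->
  (dual_var (inord (d.+2 + j)) = dual_z qh d alp zv j) *
  (dual_varV (inord (d.+2 + j)) = dual_x d alp zv j).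
Proof.
case/andP=> j0 jd; rewrite /dual_var /dual_varV inordK; last exact: xvar_lt.
by rewrite leqNgt -[X in (X < _)%N]addn0 ltn_add2l j0 /= addKn.
Qed.

Lemma frac_rel_cst (h : {rmorphism {mpoly R[i][nvar d]} -> K}) c :
  h c%:MP = cst c -> frac_rel h (cst c) (cst c).
Proof. by move=> hc; have := frac_rel_tofrac h c%:MP; rewrite hc. Qed.

Lemma frac_rel_subst (w : 'I_(nvar d) -> K) i : frac_rel (subst w) (var R i) (w i).
Proof. by have := frac_rel_tofrac (subst w) 'X_i; rewrite substX. Qed.

Let al0 k : alp k != 0. Proof. exact: alpha_neq0. Qed.
Let z0 k : zv k != 0. Proof. exact: zvar_neq0. Qed.
Let dal0 k : dual_alpha qh d alp k != 0.
Proof. exact: (dual_alpha_neq0 d qhalf_neq0 al0 k). Qed.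
Let dx0 k : dual_x d alp zv k != 0. Proof. exact: (dual_x_neq0 d al0 k z0). Qed.
Let dz0 k : dual_z qh d alp zv k != 0.
Proof. exact: (dual_z_neq0 d qhalf_neq0 al0 k z0). Qed.

Lemma dual_var_invertible : subst_invertible dual_var dual_varV.
Proof.
move=> i; set h := subst _.
have h1 : frac_rel h qh qh by apply: frac_rel_cst; rewrite /h substC.
have ha k : (k <= d.+2)%N -> frac_rel h (alp k) (dual_alpha qh d alp k).
  by move=> kd; rewrite -(dual_var_alpha kd).2; exact: frac_rel_subst.
have hz j : (0 < j <= d)%N -> frac_rel h (zv j) (dual_x d alp zv j).
  by move=> jd; rewrite -(dual_var_x jd).2; exact: frac_rel_subst.
have [[k kd ->]|[j jd ->]] := var_cases i.
  rewrite (dual_var_alpha kd).1 -[X in frac_rel _ _ X]/(alp k).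
  (* Once the variable is written as a double image, both sides are the same monomial in related
     arguments. *)
  rewrite -[X in frac_rel _ _ X](dual_alphaK qhalf_neq0 al0 kd).
  apply: Rel_dual_alpha => //;
    by [exact: qhalf_neq0 | exact: frac_relM | exact: frac_relV | exact: frac_rel1].
rewrite (dual_var_x jd).1 -[X in frac_rel _ _ X]/(zv j).
rewrite -[X in frac_rel _ _ X](dual_zK qhalf_neq0 al0 z0 jd).
apply: Rel_dual_z => //;
    by [exact: qhalf_neq0 | exact: frac_relM | exact: frac_relV | exact: frac_rel1].
Qed.

Lemma dual_varV_invertible : subst_invertible dual_varV dual_var.
Proof.
move=> i; set h := subst _.
have h1 : frac_rel h qh qh by apply: frac_rel_cst; rewrite /h substC.
have ha k : (k <= d.+2)%N -> frac_rel h (alp k) (dual_alpha qh d alp k).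
  by move=> kd; rewrite -(dual_var_alpha kd).1; exact: frac_rel_subst.
have hz j : (0 < j <= d)%N -> frac_rel h (zv j) (dual_z qh d alp zv j).
  by move=> jd; rewrite -(dual_var_x jd).1; exact: frac_rel_subst.
have [[k kd ->]|[j jd ->]] := var_cases i.
  rewrite (dual_var_alpha kd).2 -[X in frac_rel _ _ X]/(alp k).
  rewrite -[X in frac_rel _ _ X](dual_alphaK qhalf_neq0 al0 kd).
  apply: Rel_dual_alpha => //;
    by [exact: qhalf_neq0 | exact: frac_relM | exact: frac_relV | exact: frac_rel1].
rewrite (dual_var_x jd).2 -[X in frac_rel _ _ X]/(zv j).
rewrite -[X in frac_rel _ _ X](dual_xK qhalf_neq0 al0 z0 jd).
apply: Rel_dual_x => //;
    by [exact: qhalf_neq0 | exact: frac_relM | exact: frac_relV | exact: frac_rel1].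
Qed.

Lemma dual_var_inj : injective (subst dual_var).
Proof. exact: subst_inj dual_var_invertible. Qed.
Lemma dual_varV_inj : injective (subst dual_varV).
Proof. exact: subst_inj dual_varV_invertible. Qed.

(** As for [shiftm], the proof of 0 < q < 1 is an argument so that the morphism structure can be
    attached; it makes q^(1/2) nonzero. *)
Definition dual (h : 0 < q < 1) : K -> K := rsubst dual_var.
Definition dualV (h : 0 < q < 1) : K -> K := rsubst dual_varV.

Lemma dual_monoid : (dual q01 1 = 1) * {morph (dual q01) : f g / f * g}.
Proof. by split; [exact: rsubst1 dual_var_inj | exact: rsubstM dual_var_inj]. Qed.

Lemma dualV_monoid : (dualV q01 1 = 1) * {morph (dualV q01) : f g / f * g}.
Proof. by split; [exact: rsubst1 dual_varV_inj | exact: rsubstM dual_varV_inj]. Qed.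

HB.instance Definition _ := GRing.isZmodMorphism.Build K K (dual q01)
  (rsubst_is_additive dual_var_inj).
HB.instance Definition _ := GRing.isMonoidMorphism.Build K K (dual q01) dual_monoid.
HB.instance Definition _ := GRing.isZmodMorphism.Build K K (dualV q01)
  (rsubst_is_additive dual_varV_inj).
HB.instance Definition _ := GRing.isMonoidMorphism.Build K K (dualV q01) dualV_monoid.

Lemma dual_cst c : dual q01 (cst c) = cst c.
Proof. by rewrite /dual (rsubst_tofrac dual_var_inj) substC. Qed.
Lemma dualV_cst c : dualV q01 (cst c) = cst c.
Proof. by rewrite /dualV (rsubst_tofrac dual_varV_inj) substC. Qed.

Lemma dual_varE i : dual q01 (var R i) = dual_var i.
Proof. by rewrite /dual (rsubst_tofrac dual_var_inj) substX. Qed.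
Lemma dualV_varE i : dualV q01 (var R i) = dual_varV i.
Proof. by rewrite /dualV (rsubst_tofrac dual_varV_inj) substX. Qed.

Lemma dual_alphaE k : (k <= d.+2)%N -> dual q01 (alp k) = dual_alpha qh d alp k.
Proof. by move=> kd; rewrite dual_varE (dual_var_alpha kd).1. Qed.
Lemma dualV_alphaE k : (k <= d.+2)%N -> dualV q01 (alp k) = dual_alpha qh d alp k.
Proof. by move=> kd; rewrite dualV_varE (dual_var_alpha kd).2. Qed.
Lemma dual_zvarE j : (0 < j <= d)%N -> dual q01 (zv j) = dual_z qh d alp zv j.
Proof. by move=> jd; rewrite dual_varE (dual_var_x jd).1. Qed.
Lemma dualV_xvarE j : (0 < j <= d)%N -> dualV q01 (zv j) = dual_x d alp zv j.
Proof. by move=> jd; rewrite dualV_varE (dual_var_x jd).2. Qed.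

Lemma eq_on_generators (f g : {rmorphism K -> K}) :
  (forall c, f (cst c) = g (cst c)) ->
  (forall k, (k <= d.+2)%N -> f (alp k) = g (alp k)) ->
  (forall j, (0 < j <= d)%N -> f (zv j) = g (zv j)) -> f =1 g.
Proof.
move=> fc fa fz; apply: eq_on_vars => // i.
by have [[k kd ->]|[j jd ->]] := var_cases i; [exact: fa | exact: fz].
Qed.

End Duality.

(** * Conjugation by the duality *)

Lemma sum_indicator a n : \sum_(1 <= i < n.+1) (i == a)%:Z = (0 < a <= n)%N%:Z.
Proof.
elim: n => [|n IHn].
  by rewrite big_geq //; have -> : (0 < a <= 0)%N = false by lia.
by rewrite big_nat_recr //= IHn; lia.
Qed.

Section Conjugation.
Variables (R : realType) (d : nat) (q : R) (q01 : 0 < q < 1).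
Local Notation K := (ratf R d).
Local Notation D := (diffop d q01).
Local Notation alp := (@alpha R d).
Local Notation zv := (@zvar R d).
Local Notation qh := (@qhalf R d q).
Local Notation sg := (@dual R d q q01).
Local Notation sgV := (@dualV R d q q01).

Let al0 k : alp k != 0. Proof. exact: alpha_neq0. Qed.
Let z0 k : zv k != 0. Proof. exact: zvar_neq0. Qed.
Let qh0 : qh != 0. Proof. exact: qhalf_neq0. Qed.
Let dal0 k : dual_alpha qh d alp k != 0.
Proof. exact: (dual_alpha_neq0 d qh0 al0 k). Qed.
Let dz0 k : dual_z qh d alp zv k != 0.
Proof. exact: (dual_z_neq0 d qh0 al0 k z0). Qed.

Lemma dualK f : sg (sgV f) = f.
Proof.
suff : (dual q01 \o dualV q01 : {rmorphism K -> K}) =1 (idfun : {rmorphism K -> K}).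
  by move/(_ f).
apply: (eq_on_generators q01) => [c|k kd|j jd] /=.
- by rewrite dualV_cst dual_cst.
- rewrite dualV_alphaE //.
  rewrite (@morph_dual_alpha K (dual q01) qh d alp (dual_alpha qh d alp)).
  + exact: (dual_alphaK qh0 al0 kd).
  + exact: dal0.
  + exact: dual_alphaE.
  + exact: dual_cst.
  + exact: qh0.
  + exact: kd.
- rewrite dualV_xvarE //.
  rewrite (@morph_dual_x K (dual q01) d alp (dual_alpha qh d alp) zv (dual_z qh d alp zv)).
  + exact: (dual_xK qh0 al0 z0 jd).
  + exact: dal0.
  + exact: dz0.
  + exact: dual_alphaE.
  + exact: dual_zvarE.
  + exact: jd.
Qed.

Lemma dualVK f : sgV (sg f) = f.
Proof. by apply: (fmorph_inj (dual q01)); rewrite /= dualK. Qed.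

(** The image of z_j contains x_1 ... x_(d+1-j), which E^mu multiplies by q to the power mu_1 + ...
    + mu_(d+1-j). This has to match the factor q^(nu_j) by which E^nu multiplies z_j. *)
Lemma shift_dual nu mu :
  (forall j, (0 < j <= d)%N -> nu j = \sum_(1 <= i < d.+2 - j) mu i) ->
  forall f, sg (shift q nu f) = shift q mu (sg f).
Proof.
move=> numu f.
suff : (dual q01 \o shiftm q01 nu : {rmorphism K -> K}) =1
    (shiftm q01 mu \o dual q01 : {rmorphism K -> K}) by move/(_ f).
apply: (eq_on_generators q01) => [c|k kd|j jd] /=; rewrite /shiftm.
- by rewrite !dual_cst !(shift_cst d q01) dual_cst.
- rewrite (shift_alpha q01) // dual_alphaE //; symmetry.
  apply: (@morph_dual_alpha K (shiftm q01 mu) qh d alp alp).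
  + exact: al0.
  + by move=> i id; exact: (shift_alpha q01).
  + exact: (shift_cst d q01).
  + exact: qh0.
  + exact: kd.
rewrite (shift_xvar q01 nu jd) rmorphM /= dual_cst (dual_zvarE q01 jd); symmetry.
pose c i : K := cst (q%:C ^ mu i).
have qC0 : q%:C != 0 :> R[i].
  by case/andP: q01 => q0 _; rewrite eq_complex /= eqxx andbT gt_eqF.
rewrite -[shift q mu _]/(shiftm q01 mu _).
rewrite (@morph_dual_z K (shiftm q01 mu) qh d alp alp zv (fun i => c i * zv i)).
- rewrite dual_zM; congr (_ * _); rewrite numu // -rmorph_prod; congr (cst _).
  elim/big_rec2: _ => [|i x y _ ->]; first by rewrite expr0z.
  by rewrite expfzDr.
- exact: al0.
- by move=> i id; exact: (shift_alpha q01).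
- by move=> i id; exact: (shift_xvar q01).
- exact: (shift_cst d q01).
- exact: qh0.
- exact: jd.
Qed.

(* The inverse of the summation in [shift_dual]. *)
Lemma shift_dual_onto (nu : nat -> int) : let mu m := nu (d.+1 - m)%N -
    (if m == 1%N then 0 else nu (d.+2 - m)%N) in
  forall j, (0 < j <= d)%N -> nu j = \sum_(1 <= i < d.+2 - j) mu i.
Proof.
move=> mu j /andP[j0 jd].
have H m : (m < d)%N -> \sum_(1 <= i < m.+2) mu i = nu (d.+1 - m.+1)%N.
  elim: m => [|m IHm] md; first by rewrite big_nat1 /mu eqxx subr0.
  rewrite big_nat_recr //= IHm ?(ltnW md) // /mu /= -[(d.+2 - m.+2)%N]/(d.+1 - m.+1)%N.
  by rewrite addrC subrK.
have -> : (d.+2 - j = (d - j).+2)%N by lia.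
rewrite H; last by lia.
by congr nu; lia.
Qed.

Lemma is_diffop_dual (T : D) : is_diffop q (fun f => sg (T (sgV f))).
Proof.
have [s sE] := diffopP T.
(* At m = 1 the subtracted component would be the one of index d + 1. Shifts ignore that index, so
   its value is arbitrary and 0 is used instead. *)
exists [seq (sg t.1, fun m => t.2 (d.+1 - m)%N - (if m == 1%N then 0 else t.2 (d.+2 - m)%N))
  | t <- s] => f.
rewrite sE rmorph_sum big_map; apply: eq_bigr => t _ /=.
by rewrite rmorphM /= (shift_dual (@shift_dual_onto t.2)) dualK.
Qed.

Lemma is_diffop_dualV (T : D) : is_diffop q (fun f => sgV (T (sg f))).
Proof.
have [s sE] := diffopP T.
exists [seq (sgV t.1, fun j => \sum_(1 <= i < d.+2 - j) t.2 i) | t <- s] => f.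
rewrite sE rmorph_sum big_map; apply: eq_bigr => t _ /=.
rewrite rmorphM /=; congr (_ * _); apply: (fmorph_inj (dual q01)) => /=.
by rewrite dualK (@shift_dual _ t.2).
Qed.

Definition dual_op (T : D) : D := mk_diffop q01 (is_diffop_dual T).
Definition dual_opV (T : D) : D := mk_diffop q01 (is_diffop_dualV T).

Lemma dual_op_sub : {morph dual_op : S T / S - T}.
Proof. by move=> S T; apply: diffop_ext => f /=; rewrite -rmorphB. Qed.

Lemma dual_op_monoid : (dual_op 1 = 1) * {morph dual_op : S T / S * T}.
Proof.
split; first by apply: diffop_ext => f /=; rewrite dualK.
by move=> S T; apply: diffop_ext => f /=; rewrite dualVK.
Qed.

Lemma dual_op_scalable : scalable dual_op.
Proof. by move=> c T; apply: diffop_ext => f /=; rewrite rmorphM /= dual_cst. Qed.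

HB.instance Definition _ := GRing.isZmodMorphism.Build D D dual_op dual_op_sub.
HB.instance Definition _ := GRing.isMonoidMorphism.Build D D dual_op dual_op_monoid.
HB.instance Definition _ := GRing.isScalable.Build R[i] D D *:%R dual_op dual_op_scalable.

Lemma dual_op_bij : bijective dual_op.
Proof.
by exists dual_opV => T; apply: diffop_ext => f /=; rewrite ?dualVK ?dualK ?dualVK.
Qed.

Lemma dual_op_coef l : dual_op (coef l) = coef (sg l).
Proof. by apply: diffop_ext => f /=; rewrite rmorphM /= dualK. Qed.

(** The sum over i <= d + 1 - l of the exponents on the right is [l <= j] - [l < j] = [l = j]. For j
    = 1 the index d + 2 - j = d + 1 falls outside the sum, in accordance with the convention on
    E_(n_(d+1)). *)
Lemma dual_op_E j : (0 < j <= d)%N -> dual_op (E j) = E (d.+1 - j) * Einv (d.+2 - j).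
Proof.
move=> jd; apply: diffop_ext => f /=; rewrite (shift_comp q01).
rewrite (@shift_dual _ (fun i => (i == d.+1 - j)%N%:Z - (i == d.+2 - j)%N%:Z)) ?dualK //.
move=> l ld; have -> : (d.+2 - l = (d.+1 - l).+1)%N by lia.
rewrite sumrB !sum_indicator.
have -> : (0 < d.+1 - j <= d.+1 - l)%N = (l <= j)%N by lia.
have -> : (0 < d.+2 - j <= d.+1 - l)%N = (l < j)%N by lia.
by case: ltngtP.
Qed.
End Conjugation.

(** * Generated subalgebras, their commutativity and their images under morphisms *)

Section GeneratedSubalgebra.
Variables (C : fieldType) (A : algType C) (d : nat).
Implicit Types T : nat -> A.

Lemma gen_subalgP T t : reflect (forall S : {pred A}, GRing.subalg_closed S ->
  (forall k, (0 < k <= d)%N -> T k \in S) -> t \in S) (t \in gen_subalg d T).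
Proof. by rewrite inE; exact: asboolP. Qed.

Lemma gen_subalg_gen T k : (0 < k <= d)%N -> T k \in gen_subalg d T.
Proof. by move=> kd; apply/gen_subalgP => S _; exact. Qed.

Lemma gen_subalg_closed T : GRing.subalg_closed (gen_subalg d T).
Proof.
split.
- by apply/gen_subalgP => S [S1 _ _].
- move=> a u v /gen_subalgP uT /gen_subalgP vT; apply/gen_subalgP => S cS gS.
  by case: (cS) => _ + _; apply; [exact: uT | exact: vT].
- move=> u v /gen_subalgP uT /gen_subalgP vT; apply/gen_subalgP => S cS gS.
  by case: (cS) => _ _; apply; [exact: uT | exact: vT].
Qed.

(** Made boolean by classical logic, P is itself one of the closed predicates over which
    [gen_subalg] quantifies. *)
Lemma gen_subalg_ind T (P : A -> Prop) : P 1 ->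
  (forall a u v, P u -> P v -> P (a *: u + v)) ->
  (forall u v, P u -> P v -> P (u * v)) ->
  (forall k, (0 < k <= d)%N -> P (T k)) ->
  forall t, t \in gen_subalg d T -> P t.
Proof.
move=> P1 PZ PM PT t /gen_subalgP /(_ [pred u | `[< P u >]]).
rewrite inE => H; apply/asboolP; apply: H.
  split; rewrite ?inE; first exact/asboolP.
  - by move=> a u v; rewrite !inE => /asboolP Pu /asboolP Pv; apply/asboolP/PZ.
  - by move=> u v; rewrite !inE => /asboolP Pu /asboolP Pv; apply/asboolP/PM.
by move=> k kd; rewrite inE; apply/asboolP/PT.
Qed.

Lemma gen_subalg_comm_gens T (x t : A) :
  (forall k, (0 < k <= d)%N -> GRing.comm x (T k)) ->
  t \in gen_subalg d T -> GRing.comm x t.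
Proof.
move=> xT; apply: gen_subalg_ind => //; first exact: commr1.
- move=> a u v xu xv; apply: commrD => //.
  by rewrite /GRing.comm -scalerAr -scalerAl xu.
- by move=> u v; exact: commrM.
Qed.

(** The centralizer of an element is a subalgebra; this is applied first to one factor, then to the
    other. *)
Lemma gen_subalg_comm T :
  (forall k l, (0 < k <= d)%N -> (0 < l <= d)%N -> GRing.comm (T k) (T l)) ->
  {in gen_subalg d T &, forall s t, s * t = t * s}.
Proof.
move=> TT s t sT tT; apply: (gen_subalg_comm_gens _ tT) => k kd.
apply/commr_sym; apply: (gen_subalg_comm_gens _ sT) => l ld.
exact: TT.
Qed.
End GeneratedSubalgebra.

(** Images and preimages of subalgebras under b are subalgebras, and each gives one of the two
    inclusions by induction. *)
Lemma gen_subalg_morph (C : fieldType) (A B : algType C) (b : {lrmorphism A -> B})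
    (d : nat) (T : nat -> A) t :
  t \in gen_subalg d (fun k => b (T k)) <->
  exists2 s, s \in gen_subalg d T & t = b s.
Proof.
have [A1 AZ AM] := gen_subalg_closed d T.
have [B1 BZ BM] := gen_subalg_closed d (fun k => b (T k)).
split=> [|[s sT ->]].
  move: t; apply: gen_subalg_ind.
  - by exists 1 => //; rewrite rmorph1.
  - move=> a u v [u' u'T ->] [v' v'T ->]; exists (a *: u' + v'); first exact: AZ.
    by rewrite linearP.
  - move=> u v [u' u'T ->] [v' v'T ->]; exists (u' * v'); first exact: AM.
    by rewrite rmorphM.
  - by move=> k kd; exists (T k) => //; exact: gen_subalg_gen.
move: s sT; apply: gen_subalg_ind => [|a u v bu bv|u v bu bv|k kd].
- by rewrite rmorph1.
- by rewrite linearP; exact: BZ.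
- by rewrite rmorphM; exact: BM.
- exact: (gen_subalg_gen (fun k => b (T k))).
Qed.

Theorem lemma5p4 (R : realType) (d : nat) (q : R)
    (d_gt0 : (0 < d)%N) (q01 : 0 < q < 1) :
  let qhalf : ratf R d := cst (Num.sqrt q)%:C in
  exists b : {lrmorphism Dz d q01 -> Dn d q01},
    bijective b /\
    [/\ b (coef (alpha 0)) = coef (alpha 0),
        (forall j, (1 <= j <= d.+1)%N ->
           b (coef (alpha j)) =
           coef (alpha 0 * alpha d.+1 * alpha d.+2 / alpha (d.+2 - j) * qhalf)),
        b (coef (alpha d.+2)) = coef (alpha 1 / alpha 0 * qhalf^-1),
        (forall j, (1 <= j <= d)%N ->
           b (coef (zvar j)) =
           coef (alpha (d.+2 - j) / alpha 0
                 * (\prod_(1 <= i < d.+2 - j) qn i) * qhalf^-1))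
      & (forall j, (1 <= j <= d)%N ->
           b (E j) = E (d.+1 - j) * Einv (d.+2 - j))] /\
    let Ln k := b (Lz k) in
    let Az := gen_subalg d (Lz : nat -> Dz d q01) in
    let An := gen_subalg d (Ln : nat -> Dn d q01) in
    [/\ (forall k l, (1 <= k <= d)%N -> (1 <= l <= d)%N ->
           Ln k * Ln l = Ln l * Ln k),
        (forall T, T \in An <-> exists2 S, S \in Az & T = b S),
        GRing.subalg_closed An
      & {in An &, forall S T, S * T = T * S}].
Proof.
move=> qh; exists (@dual_op R d q q01 : {lrmorphism Dz d q01 -> Dn d q01}).
split; first exact: dual_op_bij.
have cE k : (k <= d.+2)%N -> dual_op (coef (alpha k) : Dz d q01) = coef (dual_alpha qh d alpha k).
  by move=> kd; rewrite dual_op_coef (dual_alphaE q01 kd).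
have comm k l : (1 <= k <= d)%N -> (1 <= l <= d)%N ->
    dual_op (Lz k : Dz d q01) * dual_op (Lz l) = dual_op (Lz l) * dual_op (Lz k).
  move=> /andP[_ kd] /andP[_ ld]; rewrite -!(rmorphM (@dual_op R d q q01)); congr (dual_op _).
  exact: Lz_comm.
split; last split.
- split.
  + exact: cE.
  + by move=> j jd; rewrite /= cE; [rewrite dual_alpha_mid | lia].
  + by rewrite /= cE // dual_alpha_last.
  + by move=> j jd; rewrite /= dual_op_coef (dual_zvarE q01 jd).
  + exact: dual_op_E.
- exact: comm.
- exact: (gen_subalg_morph (@dual_op R d q q01 : {lrmorphism Dz d q01 -> Dn d q01})).
- exact: gen_subalg_closed.
- exact: gen_subalg_comm.
Qed.
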